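(* Let $k$ be a field, $q\in k$ a nonzero element, $a,b\ge 2$ integers, and $A = k\langle X,Y\rangle/(X^a,\,XY-qYX,\,Y^b)$, with enveloping algebra $A^{e}=A\otimes_k A^{op}$. Then the complex of left $A^{e}$-modules $$\mathbb{P}\colon\ \cdots \to P_2 \xrightarrow{d_2} P_1 \xrightarrow{d_1} P_0 \xrightarrow{\mu} A \to 0,$$ with $P_n=\bigoplus_{i=0}^n A^{e} f^n_i$ free of rank $n+1$ and with the maps $d_n$ and $\mu$ given explicitly in the context, is exact, and is therefore a minimal projective resolution of the left $A^{e}$-module $A$.
   Context: Let $x,y$ denote the images of $X,Y$ in $A$; $A$ has $k$-basis $\{y^ix^j\}_{0\le i<b,\ 0\le j<a}$. $A^{op}$ is the opposite algebra and bimodules over $A$ are viewed as left modules over $A^{e}=A\otimes_k A^{op}$ (so $(w_1\otimes w_2)\cdot m = w_1 m w_2$). For each integer $s\ge 0$ define the following elements of $A^{e}$: $$\tau_1(s)=q^s(1\otimes x)-(x\otimes 1),\qquad \tau_2(s)=(1\otimes y)-q^s(y\otimes 1),$$ $$\gamma_1(s)=\sum_{j=0}^{a-1}q^{js}(x^{a-1-j}\otimes x^j),\qquad \gamma_2(s)=\sum_{j=0}^{b-1}q^{js}(y^j\otimes y^{b-1-j}).$$ For $n\ge 0$ let $P_n=\bigoplus_{i=0}^n A^{e}f^n_i$ be the free left $A^{e}$-module with basis $f^n_0,\dots,f^n_n$, with the convention $f^n_{-1}=f^n_{n+1}=0$. The map $\mu\colon P_0=A^{e}\to A$ is multiplication $w\otimes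 z\mapsto wz$. The $A^{e}$-linear maps $d_n\colon P_n\to P_{n-1}$ are given on basis elements by $$d_{2t}(f^{2t}_i)=\begin{cases}\gamma_2\!\left(\tfrac{ai}{2}\right)f^{2t-1}_i+\gamma_1\!\left(\tfrac{2bt-bi}{2}\right)f^{2t-1}_{i-1} & i \text{ even},\\[4pt] -\tau_2\!\left(\tfrac{ai-a+2}{2}\right)f^{2t-1}_i+\tau_1\!\left(\tfrac{2bt-bi-b+2}{2}\right)f^{2t-1}_{i-1} & i\text{ odd},\end{cases}$$ for $t\ge 1$, and $$d_{2t+1}(f^{2t+1}_i)=\begin{cases}\tau_2\!\left(\tfrac{ai}{2}\right)f^{2t}_i+\gamma_1\!\left(\tfrac{2bt-bi+2}{2}\right)f^{2t}_{i-1} & i \text{ even},\\[4pt] -\gamma_2\!\left(\tfrac{ai-a+2}{2}\right)f^{2t}_i+\tau_1\!\left(\tfrac{2bt-bi+b}{2}\right)f^{2t}_{i-1} & i\text{ odd},\end{cases}$$ for $t\ge 0$. (When $f^{n-1}_{i}$ or $f^{n-1}_{i-1}$ is zero by the convention, the corresponding term is zero, whatever its coefficient.) *)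

(* Defs.v *)
From HB Require Import structures.
From mathcomp Require Import all_boot all_algebra.
From mathcomp Require Import finmap monalg.
From mathcomp Require Import generic_quotient ring_quotient.
From mathcomp Require Import boolp.

Set Implicit Arguments.
Unset Strict Implicit.
Unset Printing Implicit Defensive.

Import GRing.Theory.
Local Open Scope ring_scope.
Local Open Scope quotient_scope.

Section OppositeAlgebra.
Variables (k : comNzRingType) (A : algType k).

HB.instance Definition _ :=
  GRing.Zmodule_isLmodule.Build k A^c
    (@scalerA k A) (@scale1r k A) (@scalerDr k A) (@scalerDl k A).

Fact opp_scalerAl (c : k) (u v : A^c) : c *: (u * v) = (c *: u) * v.
Proof. exact: (@scalerAr k A c v u). Qed.

HB.instance Definition _ := GRing.Lmodule_isLalgebra.Build k A^c opp_scalerAl.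

Fact opp_scalerAr (c : k) (u v : A^c) : c *: (u * v) = u * (c *: v).
Proof. exact: (@scalerAl k A c v u). Qed.

HB.instance Definition _ := GRing.Lalgebra_isAlgebra.Build k A^c opp_scalerAr.

End OppositeAlgebra.

(* The operations on quotients below are locked, each with its own opaque key:
   otherwise comparing two elements unfolds the whole construction. *)
Fact lmod_pi_key : unit. Proof. by []. Qed.
Fact lmod_scale_key : unit. Proof. by []. Qed.
Fact alg_pi_key : unit. Proof. by []. Qed.
Fact alg_mul_key : unit. Proof. by []. Qed.
Fact alg_scale_key : unit. Proof. by []. Qed.
Fact tens_key : unit. Proof. by []. Qed.
Fact tensor_lift_key : unit. Proof. by []. Qed.
Fact tensor_mul_key : unit. Proof. by []. Qed.
Fact etens_key : unit. Proof. by []. Qed.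
Fact escale_key : unit. Proof. by []. Qed.
Fact bimod_scale_key : unit. Proof. by []. Qed.
Fact envelope_mul_key : unit. Proof. by []. Qed.
Fact qci_x_key : unit. Proof. by []. Qed.
Fact qci_y_key : unit. Proof. by []. Qed.

(** * Quotient of a module by the submodule generated by a set *)

Inductive submod_gen (k : pzRingType) (V : lmodType k) (S : V -> Prop) :
    V -> Prop :=
  | SubmodGen0 : submod_gen S 0
  | SubmodGenD c s u :
      S s -> submod_gen S u -> submod_gen S (c *: s + u).

Section LmodQuotient.
Variables (k : pzRingType) (V : lmodType k) (S : V -> Prop).

Definition submod_gen_pred : {pred V} := fun v => `[< submod_gen S v >].

Lemma submod_gen_lin c u v :
  submod_gen S u -> submod_gen S v -> submod_gen S (c *: u + v).
Proof.
move=> Su Sv; elim: Su => [|e s w Ss _ IH]; first by rewrite scaler0 add0r.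
by rewrite scalerDr scalerA -addrA; apply: SubmodGenD.
Qed.

Fact submod_gen_zmod_closed : zmod_closed submod_gen_pred.
Proof.
split=> [|u v /asboolP Su /asboolP Sv]; apply/asboolP.
  exact: SubmodGen0.
by rewrite addrC -scaleN1r; apply: submod_gen_lin.
Qed.

HB.instance Definition _ :=
  GRing.isZmodClosed.Build V submod_gen_pred submod_gen_zmod_closed.

Definition lmod_quot := Quotient.quot submod_gen_pred.

HB.instance Definition _ := GRing.Zmodule.on lmod_quot.

Definition lmod_pi : V -> lmod_quot :=
  locked_with lmod_pi_key (fun v => \pi_lmod_quot v).

Lemma lmod_piE v : lmod_pi v = \pi_lmod_quot v.
Proof. by rewrite /lmod_pi unlock. Qed.

Lemma lmod_piP u v : lmod_pi u = lmod_pi v <-> submod_gen S (u - v).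
Proof.
split=> [/eqP|Suv].
  by rewrite !lmod_piE -Quotient.idealrBE => /asboolP.
by apply/eqP; rewrite !lmod_piE -Quotient.idealrBE; apply/asboolP.
Qed.

Lemma lmod_reprK (p : lmod_quot) : lmod_pi (repr p) = p.
Proof. by rewrite lmod_piE; exact: reprK. Qed.

Lemma lmod_piD u v : lmod_pi (u + v) = lmod_pi u + lmod_pi v.
Proof. by rewrite !lmod_piE !piE. Qed.

Definition lmod_quot_scale : k -> lmod_quot -> lmod_quot :=
  locked_with lmod_scale_key (fun c p => lmod_pi (c *: repr p)).

Lemma lmod_quot_scaleE c v : lmod_quot_scale c (lmod_pi v) = lmod_pi (c *: v).
Proof.
rewrite /lmod_quot_scale unlock.
apply/lmod_piP; rewrite -scalerBr -[_ *: _]addr0.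
by apply: submod_gen_lin; [apply/lmod_piP; rewrite lmod_reprK | constructor].
Qed.

Fact lmod_quot_scalerA c e p :
  lmod_quot_scale c (lmod_quot_scale e p) = lmod_quot_scale (c * e) p.
Proof. by rewrite -[p]lmod_reprK !lmod_quot_scaleE scalerA. Qed.

Fact lmod_quot_scale1r : left_id 1 lmod_quot_scale.
Proof. by move=> p; rewrite -[p]lmod_reprK lmod_quot_scaleE scale1r. Qed.

Fact lmod_quot_scalerDr : right_distributive lmod_quot_scale +%R.
Proof.
move=> c p r; rewrite -[p]lmod_reprK -[r]lmod_reprK -lmod_piD.
by rewrite !lmod_quot_scaleE scalerDr lmod_piD.
Qed.

Fact lmod_quot_scalerDl p : {morph lmod_quot_scale^~ p : c e / c + e}.
Proof.
by move=> c e; rewrite -[p]lmod_reprK !lmod_quot_scaleE scalerDl lmod_piD.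
Qed.

HB.instance Definition _ :=
  GRing.Zmodule_isLmodule.Build k lmod_quot lmod_quot_scalerA
    lmod_quot_scale1r lmod_quot_scalerDr lmod_quot_scalerDl.

Lemma lmod_piZ c v : lmod_pi (c *: v) = c *: lmod_pi v.
Proof. by rewrite -lmod_quot_scaleE. Qed.

End LmodQuotient.

(** * Quotient of an algebra by the two-sided ideal generated by a set *)

Inductive ideal_gen (R : pzRingType) (S : R -> Prop) : R -> Prop :=
  | IdealGen0 : ideal_gen S 0
  | IdealGenD l s r u : S s -> ideal_gen S u -> ideal_gen S (l * s * r + u).

Section IdealGen.
Variables (R : pzRingType) (S : R -> Prop).

Lemma ideal_genD u v : ideal_gen S u -> ideal_gen S v -> ideal_gen S (u + v).
Proof.
move=> Su Sv; elim: Su => [|l s r w Ss _ IH]; first by rewrite add0r.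
by rewrite -addrA; apply: IdealGenD.
Qed.

Lemma ideal_genMl w u : ideal_gen S u -> ideal_gen S (w * u).
Proof.
elim=> [|l s r v Ss _ IH]; first by rewrite mulr0; constructor.
by rewrite mulrDr !mulrA; apply: IdealGenD.
Qed.

Lemma ideal_genMr w u : ideal_gen S u -> ideal_gen S (u * w).
Proof.
elim=> [|l s r v Ss _ IH]; first by rewrite mul0r; constructor.
by rewrite mulrDl -mulrA; apply: IdealGenD.
Qed.

Lemma ideal_genN u : ideal_gen S u -> ideal_gen S (- u).
Proof. by move=> Su; rewrite -mulN1r; apply: ideal_genMl. Qed.

Lemma ideal_gen_mem s : S s -> ideal_gen S s.
Proof.
move=> Ss; rewrite -[s]mul1r -[1 * s]mulr1 -[1 * s * 1]addr0.
by apply: IdealGenD => //; apply: IdealGen0.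
Qed.

End IdealGen.

Section AlgQuotient.
Variables (k : comNzRingType) (A : algType k) (S : A -> Prop).
Hypothesis S_proper : ~ ideal_gen S 1.

Definition ideal_gen_pred : {pred A} := fun v => `[< ideal_gen S v >].

Fact ideal_gen_zmod_closed : zmod_closed ideal_gen_pred.
Proof.
split=> [|u v /asboolP Su /asboolP Sv]; apply/asboolP.
  exact: IdealGen0.
by apply: ideal_genD => //; apply: ideal_genN.
Qed.

HB.instance Definition _ :=
  GRing.isZmodClosed.Build A ideal_gen_pred ideal_gen_zmod_closed.

(* [algType] requires [1 != 0], hence the properness argument. *)
Definition alg_quot of ~ ideal_gen S 1 := Quotient.quot ideal_gen_pred.
Local Notation Q := (alg_quot S_proper).

HB.instance Definition _ := GRing.Zmodule.on Q.

Definition alg_pi : A -> Q :=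
  locked_with alg_pi_key (fun v => \pi_(Quotient.quot ideal_gen_pred) v).

Lemma alg_piE v : alg_pi v = \pi_(Quotient.quot ideal_gen_pred) v.
Proof. by rewrite /alg_pi unlock. Qed.

Lemma alg_piP u v : alg_pi u = alg_pi v <-> ideal_gen S (u - v).
Proof.
split=> [/eqP|Suv].
  by rewrite !alg_piE -Quotient.idealrBE => /asboolP.
by apply/eqP; rewrite !alg_piE -Quotient.idealrBE; apply/asboolP.
Qed.

Lemma alg_reprK (p : Q) : alg_pi (repr p) = p.
Proof. by rewrite alg_piE; exact: reprK. Qed.

Lemma alg_piD u v : alg_pi (u + v) = alg_pi u + alg_pi v.
Proof. by rewrite !alg_piE !piE. Qed.

Lemma alg_repr_pi v : ideal_gen S (repr (alg_pi v) - v).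
Proof. by apply/alg_piP; rewrite alg_reprK. Qed.

Definition alg_quot_mul : Q -> Q -> Q :=
  locked_with alg_mul_key (fun p r => alg_pi (repr p * repr r)).

Lemma alg_quot_mulE u v : alg_quot_mul (alg_pi u) (alg_pi v) = alg_pi (u * v).
Proof.
rewrite /alg_quot_mul unlock.
apply/alg_piP; set u' := repr _; set v' := repr _.
have -> : u' * v' - u * v = (u' - u) * v' + u * (v' - v).
  by rewrite mulrBl mulrBr addrA subrK.
by apply: ideal_genD; [apply: ideal_genMr | apply: ideal_genMl];
   apply: alg_repr_pi.
Qed.

Fact alg_quot_mulA : associative alg_quot_mul.
Proof.
move=> p r s; rewrite -[p]alg_reprK -[r]alg_reprK -[s]alg_reprK.
by rewrite !alg_quot_mulE mulrA.
Qed.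

Fact alg_quot_mul1r : left_id (alg_pi 1) alg_quot_mul.
Proof. by move=> p; rewrite -[p]alg_reprK alg_quot_mulE mul1r. Qed.

Fact alg_quot_mulr1 : right_id (alg_pi 1) alg_quot_mul.
Proof. by move=> p; rewrite -[p]alg_reprK alg_quot_mulE mulr1. Qed.

Fact alg_quot_mulDl : left_distributive alg_quot_mul +%R.
Proof.
move=> p r s; rewrite -[p]alg_reprK -[r]alg_reprK -[s]alg_reprK.
by rewrite -alg_piD !alg_quot_mulE mulrDl alg_piD.
Qed.

Fact alg_quot_mulDr : right_distributive alg_quot_mul +%R.
Proof.
move=> p r s; rewrite -[p]alg_reprK -[r]alg_reprK -[s]alg_reprK.
by rewrite -alg_piD !alg_quot_mulE mulrDr alg_piD.
Qed.

Fact alg_quot_1neq0 : alg_pi 1 != 0.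
Proof.
have alg_pi0 : alg_pi 0 = 0 by rewrite alg_piE piE.
by apply/eqP; rewrite -alg_pi0 => /alg_piP; rewrite subr0.
Qed.

HB.instance Definition _ :=
  GRing.Zmodule_isNzRing.Build Q alg_quot_mulA alg_quot_mul1r
    alg_quot_mulr1 alg_quot_mulDl alg_quot_mulDr alg_quot_1neq0.

Definition alg_quot_scale : k -> Q -> Q :=
  locked_with alg_scale_key (fun c p => alg_pi (c *: repr p)).

Lemma alg_quot_scaleE c v : alg_quot_scale c (alg_pi v) = alg_pi (c *: v).
Proof.
rewrite /alg_quot_scale unlock.
apply/alg_piP; rewrite -scalerBr -[_ - _]mul1r scalerAl.
by apply: ideal_genMl; apply: alg_repr_pi.
Qed.

Fact alg_quot_scalerA c e p :
  alg_quot_scale c (alg_quot_scale e p) = alg_quot_scale (c * e) p.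
Proof. by rewrite -[p]alg_reprK !alg_quot_scaleE scalerA. Qed.

Fact alg_quot_scale1r : left_id 1 alg_quot_scale.
Proof. by move=> p; rewrite -[p]alg_reprK alg_quot_scaleE scale1r. Qed.

Fact alg_quot_scalerDr : right_distributive alg_quot_scale +%R.
Proof.
move=> c p r; rewrite -[p]alg_reprK -[r]alg_reprK -alg_piD.
by rewrite !alg_quot_scaleE scalerDr alg_piD.
Qed.

Fact alg_quot_scalerDl p : {morph alg_quot_scale^~ p : c e / c + e}.
Proof.
by move=> c e; rewrite -[p]alg_reprK !alg_quot_scaleE scalerDl alg_piD.
Qed.

HB.instance Definition _ :=
  GRing.Zmodule_isLmodule.Build k Q alg_quot_scalerA
    alg_quot_scale1r alg_quot_scalerDr alg_quot_scalerDl.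

Lemma alg_piM u v : alg_pi (u * v) = alg_pi u * alg_pi v.
Proof. by rewrite -alg_quot_mulE. Qed.

Lemma alg_pi1 : alg_pi 1 = 1.
Proof. by []. Qed.

Lemma alg_piZ c v : alg_pi (c *: v) = c *: alg_pi v.
Proof. by rewrite -alg_quot_scaleE. Qed.

Fact alg_quot_scalerAl (c : k) (p r : Q) : c *: (p * r) = (c *: p) * r.
Proof.
rewrite -[p]alg_reprK -[r]alg_reprK -alg_piM -!alg_piZ -alg_piM.
by rewrite scalerAl.
Qed.

HB.instance Definition _ := GRing.Lmodule_isLalgebra.Build k Q alg_quot_scalerAl.

Fact alg_quot_scalerAr (c : k) (p r : Q) : c *: (p * r) = p * (c *: r).
Proof.
rewrite -[p]alg_reprK -[r]alg_reprK -alg_piM -!alg_piZ -alg_piM.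
by rewrite scalerAr.
Qed.

HB.instance Definition _ := GRing.Lalgebra_isAlgebra.Build k Q alg_quot_scalerAr.

End AlgQuotient.

(** * Tensor products over a commutative ring

    [tensor A B] is the free module on [A * B] modulo the bilinearity
    relations. *)

Section TensorModule.
Variables (k : comNzRingType) (A B : lmodType k).

Local Notation F := {malg k[(A * B)%type]}.
Local Notation "[ u , v ]" := (<< (u, v) >> : F).

Inductive tensor_relation : F -> Prop :=
  | TensorDl u u' v : tensor_relation ([u + u', v] - ([u, v] + [u', v]))
  | TensorDr u v v' : tensor_relation ([u, v + v'] - ([u, v] + [u, v']))
  | TensorZl c u v : tensor_relation ([c *: u, v] - c *: [u, v])
  | TensorZr c u v : tensor_relation ([u, c *: v] - c *: [u, v]).

Definition tensor := lmod_quot tensor_relation.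

HB.instance Definition _ := GRing.Lmodule.on tensor.

Definition tens : A -> B -> tensor :=
  locked_with tens_key (fun u v => lmod_pi tensor_relation [u, v]).

Lemma tens_unlock u v : tens u v = lmod_pi tensor_relation [u, v].
Proof. by rewrite /tens unlock. Qed.

Lemma tensor_rel_eq (p r : F) :
  tensor_relation (p - r) ->
  lmod_pi tensor_relation p = lmod_pi tensor_relation r.
Proof.
move=> prP; apply/lmod_piP; rewrite -[p - r]scale1r -[1 *: (p - r)]addr0.
by apply: SubmodGenD => //; apply: SubmodGen0.
Qed.

Lemma tensDl u u' v : tens (u + u') v = tens u v + tens u' v.
Proof. by rewrite !tens_unlock -lmod_piD; apply: tensor_rel_eq; exact: TensorDl. Qed.

Lemma tensDr u v v' : tens u (v + v') = tens u v + tens u v'.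
Proof. by rewrite !tens_unlock -lmod_piD; apply: tensor_rel_eq; exact: TensorDr. Qed.

Lemma tensZl c u v : tens (c *: u) v = c *: tens u v.
Proof. by rewrite !tens_unlock -lmod_piZ; apply: tensor_rel_eq; exact: TensorZl. Qed.

Lemma tensZr c u v : tens u (c *: v) = c *: tens u v.
Proof. by rewrite !tens_unlock -lmod_piZ; apply: tensor_rel_eq; exact: TensorZr. Qed.

Lemma tens0l v : tens 0 v = 0.
Proof. by rewrite -[X in tens X _](scale0r 0) tensZl scale0r. Qed.

Lemma tens0r u : tens u 0 = 0.
Proof. by rewrite -[X in tens _ X](scale0r 0) tensZr scale0r. Qed.

Lemma tensNl u v : tens (- u) v = - tens u v.
Proof. by rewrite -scaleN1r tensZl scaleN1r. Qed.

Lemma tensNr u v : tens u (- v) = - tens u v.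
Proof. by rewrite -scaleN1r tensZr scaleN1r. Qed.

Lemma tensor_ind (Q : tensor -> Prop) :
  Q 0 -> (forall u v p, Q p -> Q (tens u v + p)) -> forall p, Q p.
Proof.
move=> Q0 QD p; rewrite -[p]lmod_reprK; set g : F := repr p.
rewrite (monalgE g); elim: (enum_fset _) => [|[u v] s IH].
  rewrite big_nil; suff -> : lmod_pi tensor_relation 0 = 0 by [].
  by rewrite -[X in lmod_pi _ X](scale0r 0) lmod_piZ scale0r.
rewrite big_cons lmod_piD.
have -> : << g@_(u, v) *g (u, v) >> = g@_(u, v) *: [u, v] :> F.
  by apply/malgP => w; rewrite mcoeffZ !mcoeffU; case: eqP; rewrite ?mulr1 ?mulr0.
by rewrite lmod_piZ -tens_unlock -tensZl; apply: QD.
Qed.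

Section Lift.
Variables (M : lmodType k) (f : A -> B -> M).

Definition tensor_bilinear : Prop :=
  [/\ forall u u' v, f (u + u') v = f u v + f u' v,
      forall u v v', f u (v + v') = f u v + f u v',
      forall c u v, f (c *: u) v = c *: f u v &
      forall c u v, f u (c *: v) = c *: f u v].

Definition malg_lift (g : F) : M := \sum_(w <- msupp g) g@_w *: f w.1 w.2.

Lemma malg_liftEw (d : {fset A * B}) (g : F) :
  (msupp g `<=` d)%fset -> malg_lift g = \sum_(w <- d) g@_w *: f w.1 w.2.
Proof.
move=> le_gd; rewrite /malg_lift (big_fset_incl _ le_gd) // => w _ /mcoeff_outdom.
by move=> ->; rewrite scale0r.
Qed.

Lemma malg_lift_lin c g h : malg_lift (c *: g + h) = c *: malg_lift g + malg_lift h.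
Proof.
pose d := (msupp g `|` msupp h `|` msupp (c *: g + h))%fset.
have [lg lh] : (msupp g `<=` d)%fset /\ (msupp h `<=` d)%fset.
  by split; apply/fsubsetP => w wS; rewrite /d !in_fsetU wS ?orbT.
rewrite (malg_liftEw lg) (malg_liftEw lh) (@malg_liftEw d) ?fsubsetUr //.
rewrite scaler_sumr -big_split /=; apply: eq_bigr => w _.
by rewrite mcoeffD mcoeffZ scalerDl scalerA.
Qed.

Lemma malg_liftU u v : malg_lift [u, v] = f u v.
Proof. by rewrite /malg_lift msuppU oner_eq0 big_seq_fset1 mcoeffUU scale1r. Qed.

(* The linear map induced by [f], meaningful when [f] is bilinear. *)
Definition tensor_lift : tensor -> M :=
  locked_with tensor_lift_key (fun p => malg_lift (repr p)).

Lemma tensor_lift_unlock p : tensor_lift p = malg_lift (repr p).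
Proof. by rewrite /tensor_lift unlock. Qed.

Hypothesis f_bilin : tensor_bilinear.

Lemma malg_lift_rel g : submod_gen tensor_relation g -> malg_lift g = 0.
Proof.
have lin0 : malg_lift 0 = 0 by rewrite /malg_lift msupp0 big_seq_fset0.
have linZ c g' : malg_lift (c *: g') = c *: malg_lift g'.
  by rewrite -[_ *: _]addr0 malg_lift_lin lin0 addr0.
have linD g' h : malg_lift (g' + h) = malg_lift g' + malg_lift h.
  by rewrite -[g']scale1r malg_lift_lin !scale1r.
have linB g' h : malg_lift (g' - h) = malg_lift g' - malg_lift h.
  by rewrite -[- h in LHS]scaleN1r linD linZ scaleN1r.
case: f_bilin => fDl fDr fZl fZr.
elim=> [//|c s u Ss _ IH]; rewrite malg_lift_lin IH addr0.
by case: Ss => *; rewrite linB ?linD ?linZ !malg_liftU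
  ?fDl ?fDr ?fZl ?fZr subrr scaler0.
Qed.

Lemma tensor_lift_pi g : tensor_lift (lmod_pi tensor_relation g) = malg_lift g.
Proof.
rewrite tensor_lift_unlock; set h : F := repr _.
have : malg_lift (h - g) = 0.
  by apply: malg_lift_rel; apply/lmod_piP; rewrite lmod_reprK.
by rewrite addrC -[- g]scaleN1r malg_lift_lin scaleN1r addrC => /subr0_eq.
Qed.

Lemma tensor_liftE u v : tensor_lift (tens u v) = f u v.
Proof. by rewrite tens_unlock tensor_lift_pi malg_liftU. Qed.

Lemma tensor_lift_lin c p r :
  tensor_lift (c *: p + r) = c *: tensor_lift p + tensor_lift r.
Proof.
rewrite -[p]lmod_reprK -[r]lmod_reprK -lmod_piZ -lmod_piD !tensor_lift_pi.
exact: malg_lift_lin.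
Qed.

Lemma tensor_liftD p r : tensor_lift (p + r) = tensor_lift p + tensor_lift r.
Proof. by rewrite -[p]scale1r tensor_lift_lin !scale1r. Qed.

Lemma tensor_lift0 : tensor_lift 0 = 0.
Proof. by rewrite -(tens0l 0) tensor_liftE; case: f_bilin => _ _ fZl _;
  rewrite -[X in f X _](scale0r 0) fZl scale0r. Qed.

Lemma tensor_liftZ c p : tensor_lift (c *: p) = c *: tensor_lift p.
Proof. by rewrite -[_ *: _]addr0 tensor_lift_lin tensor_lift0 addr0. Qed.

End Lift.

Lemma eq_tensor_lift (M : lmodType k) (f g : A -> B -> M) :
  (forall u v, f u v = g u v) -> tensor_lift f =1 tensor_lift g.
Proof. by move=> fg p; rewrite !tensor_lift_unlock; apply: eq_bigr => w _; rewrite fg. Qed.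

Lemma tensor_lift_fun_lin (M : lmodType k) c (f g : A -> B -> M) p :
  tensor_lift (fun u v => c *: f u v + g u v) p
    = c *: tensor_lift f p + tensor_lift g p.
Proof.
rewrite !tensor_lift_unlock /malg_lift scaler_sumr -big_split; apply: eq_bigr => w _.
by rewrite /= scalerDr !scalerA (mulrC c).
Qed.

End TensorModule.

Section TensorAlgebra.
Variables (k : comNzRingType) (A B : algType k).
Local Notation T := (tensor A B).

Definition tensor_mul1 (u : A) (v : B) : T -> T :=
  tensor_lift (fun u' v' => tens (u * u') (v * v')).

Lemma tensor_mul1_bilin (u : A) (v : B) :
  tensor_bilinear (fun u' v' => tens (u * u') (v * v') : T).
Proof.
split=> *; rewrite ?mulrDr ?tensDl ?tensDr //.
  by rewrite -scalerAr tensZl.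
by rewrite -scalerAr tensZr.
Qed.

Lemma tensor_mul1E u v u' v' :
  tensor_mul1 u v (tens u' v') = tens (u * u') (v * v').
Proof. exact: (tensor_liftE (tensor_mul1_bilin u v)). Qed.

(* [(u ⊗ v) * (u' ⊗ v') = (u * u') ⊗ (v * v')], see [tensM]. *)
Definition tensor_mul : T -> T -> T :=
  locked_with tensor_mul_key (fun p r => tensor_lift (fun u v => tensor_mul1 u v r) p).

Lemma tensor_mul_unlock p r :
  tensor_mul p r = tensor_lift (fun u v => tensor_mul1 u v r) p.
Proof. by rewrite /tensor_mul unlock. Qed.

Lemma tensor_mul_bilin (r : T) :
  tensor_bilinear (fun u v => tensor_mul1 u v r).
Proof.
have ext (f g : A -> B -> T) : (forall u v, f u v = g u v) ->
  tensor_lift f r = tensor_lift g r by move=> fg; apply: eq_tensor_lift.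
have addE (f g : A -> B -> T) :
    tensor_lift f r + tensor_lift g r = tensor_lift (fun u v => f u v + g u v) r.
  rewrite -[tensor_lift f r]scale1r -tensor_lift_fun_lin; apply: ext => u v.
  by rewrite scale1r.
have scaleE c (f : A -> B -> T) :
    c *: tensor_lift f r = tensor_lift (fun u v => c *: f u v) r.
  rewrite !tensor_lift_unlock /malg_lift scaler_sumr; apply: eq_bigr => w _.
  by rewrite !scalerA mulrC.
split=> *; rewrite /tensor_mul1 ?addE ?scaleE; apply: ext => u' v'.
- by rewrite mulrDl tensDl.
- by rewrite mulrDl tensDr.
- by rewrite -scalerAl tensZl.
- by rewrite -scalerAl tensZr.
Qed.

Lemma tens_mulE u v r : tensor_mul (tens u v) r = tensor_mul1 u v r.
Proof. by rewrite tensor_mul_unlock (tensor_liftE (tensor_mul_bilin r)). Qed.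

Lemma tens_mul_tens u v u' v' :
  tensor_mul (tens u v) (tens u' v') = tens (u * u') (v * v').
Proof. by rewrite tens_mulE tensor_mul1E. Qed.

Fact tensor_mulDl : left_distributive tensor_mul +%R.
Proof.
move=> p r s; rewrite !tensor_mul_unlock.
exact: (tensor_liftD (tensor_mul_bilin s)).
Qed.

Fact tensor_mul0r r : tensor_mul 0 r = 0.
Proof. by rewrite tensor_mul_unlock (tensor_lift0 (tensor_mul_bilin r)). Qed.

Fact tensor_mulDr : right_distributive tensor_mul +%R.
Proof.
move=> p r s; elim/tensor_ind: p => [|u v p IH].
  by rewrite !tensor_mul0r addr0.
rewrite !tensor_mulDl IH !tens_mulE /tensor_mul1.
by rewrite (tensor_liftD (tensor_mul1_bilin u v)) addrACA.
Qed.

Fact tensor_mulr0 p : tensor_mul p 0 = 0.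
Proof. by apply: (addrI (tensor_mul p 0)); rewrite -tensor_mulDr !addr0. Qed.

Fact tensor_mulA : associative tensor_mul.
Proof.
move=> p r s; elim/tensor_ind: p => [|u v p IH]; first by rewrite !tensor_mul0r.
rewrite !tensor_mulDl IH; congr (_ + _); clear IH.
elim/tensor_ind: r => [|u' v' r IH'].
  by rewrite tensor_mul0r !tensor_mulr0 tensor_mul0r.
rewrite !(tensor_mulDl, tensor_mulDr) IH'; congr (_ + _); clear IH'.
elim/tensor_ind: s => [|u'' v'' s IH'']; first by rewrite !tensor_mulr0.
by rewrite !tensor_mulDr IH'' !tens_mul_tens !mulrA.
Qed.

Fact tensor_mul1r : left_id (tens 1 1) tensor_mul.
Proof.
move=> p; elim/tensor_ind: p => [|u v p IH]; first by rewrite tensor_mulr0.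
by rewrite tensor_mulDr IH tens_mul_tens !mul1r.
Qed.

Fact tensor_mulr1 : right_id (tens 1 1) tensor_mul.
Proof.
move=> p; elim/tensor_ind: p => [|u v p IH]; first by rewrite tensor_mul0r.
by rewrite tensor_mulDl IH tens_mul_tens !mulr1.
Qed.

HB.instance Definition _ :=
  GRing.Zmodule_isPzRing.Build T tensor_mulA tensor_mul1r tensor_mulr1
    tensor_mulDl tensor_mulDr.

Lemma tensM (u u' : A) (v v' : B) :
  tens u v * tens u' v' = tens (u * u') (v * v') :> T.
Proof. exact: tens_mul_tens. Qed.

Lemma tens11 : tens 1 1 = 1 :> T.
Proof. by []. Qed.

Fact tensor_scalerAl (c : k) (p r : T) : c *: (p * r) = (c *: p) * r.
Proof.
rewrite /GRing.mul /= !tensor_mul_unlock.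
by rewrite (tensor_liftZ (tensor_mul_bilin r)).
Qed.

Fact tensor_scalerAr (c : k) (p r : T) : c *: (p * r) = p * (c *: r).
Proof.
elim/tensor_ind: p => [|u v p IH]; first by rewrite !mul0r scaler0.
rewrite !mulrDl scalerDr IH; congr (_ + _); rewrite /GRing.mul /= !tens_mulE.
by rewrite /tensor_mul1 (tensor_liftZ (tensor_mul1_bilin u v)).
Qed.

End TensorAlgebra.

(** * The enveloping algebra [A ⊗ A^c] and [A] as a left module over it *)

Section Envelope.
Variables (k : comNzRingType) (A : algType k).

Definition envelope : pzRingType := GRing.PzRing.clone (tensor A A^c) _.

Definition etens : A -> A -> envelope :=
  locked_with etens_key (@tens k A A^c).

Lemma etens_unlock w z : etens w z = @tens k A A^c w z.
Proof. by rewrite /etens unlock. Qed.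

(* The [k]-module structure of [A ⊗ A^c], seen on the ring [envelope]. *)
Definition escale : k -> envelope -> envelope :=
  locked_with escale_key (fun c (e : tensor A A^c) => c *: e).

Lemma escale_unlock c (e : envelope) : escale c e = c *: (e : tensor A A^c).
Proof. by rewrite /escale unlock. Qed.

Lemma escale_etens c w z : escale c (etens w z) = etens (c *: w) z.
Proof. by rewrite escale_unlock !etens_unlock tensZl. Qed.

Lemma escale1 e : escale 1 e = e.
Proof. by rewrite escale_unlock scale1r. Qed.

Lemma etensM w z w' z' : etens w z * etens w' z' = etens (w * w') (z' * z).
Proof. by rewrite !etens_unlock tensM. Qed.

Lemma etens11 : etens 1 1 = 1.
Proof. by rewrite etens_unlock tens11. Qed.

Lemma envelope_ind (Q : envelope -> Prop) :
  Q 0 -> (forall w z e, Q e -> Q (etens w z + e)) -> forall e, Q e.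
Proof.
move=> Q0 QD; apply: (@tensor_ind k A A^c Q) => // w z e Qe.
by rewrite -etens_unlock; apply: QD.
Qed.

(* A copy of [A], to carry the [envelope]-module structure: [A] itself is
   already a [k]-module. *)
Definition bimod : Type := A.

HB.instance Definition _ := GRing.Zmodule.on bimod.

(* [(w ⊗ z) *: m = w * m * z], see [bimod_scaleE]. *)
Definition bimod_scale : envelope -> bimod -> bimod :=
  locked_with bimod_scale_key
    (fun e m => tensor_lift (fun (w : A) (z : A^c) => w * (m : A) * (z : A)) e).

Lemma bimod_scale_unlock e m :
  bimod_scale e m =
    tensor_lift (fun (w : A) (z : A^c) => w * (m : A) * (z : A)) e.
Proof. by rewrite /bimod_scale unlock. Qed.

Lemma bimod_scale_bilin (m : A) :
  tensor_bilinear (fun (w : A) (z : A^c) => w * m * (z : A)).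
Proof.
split=> [u u' v|u v v'|c u v|c u v]; rewrite ?mulrDl ?mulrDr //.
  by rewrite -!scalerAl.
by rewrite -scalerAr.
Qed.

Lemma bimod_scale_tens (w z : A) (m : bimod) :
  bimod_scale (etens w z) m = w * (m : A) * z.
Proof. by rewrite bimod_scale_unlock etens_unlock (tensor_liftE (bimod_scale_bilin m)). Qed.

Lemma bimod_scale_addl (m : bimod) :
  {morph bimod_scale^~ m : e e' / e + e'}.
Proof.
move=> e e'; rewrite !bimod_scale_unlock.
exact: (tensor_liftD (bimod_scale_bilin m)).
Qed.

Lemma bimod_scale0 (m : bimod) : bimod_scale 0 m = 0.
Proof. by rewrite bimod_scale_unlock; apply: (tensor_lift0 (bimod_scale_bilin m)). Qed.

Lemma bimod_scale_addr : right_distributive bimod_scale +%R.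
Proof.
move=> e m m'; elim/envelope_ind: e => [|w z e IH].
  by rewrite !bimod_scale0 addr0.
rewrite !bimod_scale_addl IH !bimod_scale_tens addrACA; congr (_ + _).
by rewrite mulrDr mulrDl.
Qed.

Lemma bimod_scale0r (e : envelope) : bimod_scale e 0 = 0.
Proof. by apply: (addrI (bimod_scale e 0)); rewrite -bimod_scale_addr !addr0. Qed.

Lemma bimod_scaleA (e e' : envelope) (m : bimod) :
  bimod_scale e (bimod_scale e' m) = bimod_scale (e * e') m.
Proof.
elim/envelope_ind: e => [|w z e IH]; first by rewrite mul0r !bimod_scale0.
rewrite mulrDl !bimod_scale_addl IH; congr (_ + _); clear IH.
elim/envelope_ind: e' => [|w' z' e' IH].
  by rewrite mulr0 !bimod_scale0 bimod_scale0r.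
rewrite mulrDr !bimod_scale_addl bimod_scale_addr IH etensM.
by rewrite !bimod_scale_tens; congr (_ + _); rewrite !mulrA.
Qed.

Lemma bimod_scale1 : left_id 1 bimod_scale.
Proof. by move=> m; rewrite -etens11 bimod_scale_tens mul1r mulr1. Qed.

HB.instance Definition _ :=
  GRing.Zmodule_isLmodule.Build envelope bimod bimod_scaleA bimod_scale1
    bimod_scale_addr bimod_scale_addl.

Lemma bimod_scaleE (w z m : A) :
  etens w z *: (m : bimod) = w * m * z :> A.
Proof. exact: bimod_scale_tens. Qed.

(* The multiplication map [A ⊗ A^c -> A]. *)
Definition envelope_mul : envelope -> bimod :=
  locked_with envelope_mul_key (tensor_lift (fun (w : A) (z : A^c) => w * (z : A))).

Lemma envelope_mul_unlock e :
  envelope_mul e = tensor_lift (fun (w : A) (z : A^c) => w * (z : A)) e.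
Proof. by rewrite /envelope_mul unlock. Qed.

Lemma envelope_mul_bilin :
  tensor_bilinear (fun (w : A) (z : A^c) => w * (z : A)).
Proof.
split=> [u u' v|u v v'|c u v|c u v].
- by rewrite mulrDl.
- by rewrite mulrDr.
- by rewrite -scalerAl.
- by rewrite -scalerAr.
Qed.

Lemma envelope_mul_tens (w z : A) : envelope_mul (etens w z) = w * z.
Proof. by rewrite envelope_mul_unlock etens_unlock (tensor_liftE envelope_mul_bilin). Qed.

Lemma envelope_mul0 : envelope_mul 0 = 0.
Proof. by rewrite envelope_mul_unlock; apply: (tensor_lift0 envelope_mul_bilin). Qed.

Lemma envelope_mulD e e' :
  envelope_mul (e + e') = envelope_mul e + envelope_mul e'.
Proof. by rewrite !envelope_mul_unlock; apply: (tensor_liftD envelope_mul_bilin). Qed.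

Lemma envelope_mulM (c e : envelope) :
  envelope_mul (c * e) = c *: envelope_mul e.
Proof.
elim/envelope_ind: c => [|w z c IH]; first by rewrite mul0r scale0r envelope_mul0.
rewrite mulrDl scalerDl envelope_mulD IH; congr (_ + _); clear IH.
elim/envelope_ind: e => [|w' z' e IH].
  by rewrite mulr0 envelope_mul0 scaler0.
rewrite mulrDr !envelope_mulD scalerDr IH etensM; congr (_ + _).
by rewrite !envelope_mul_tens bimod_scaleE !mulrA.
Qed.

End Envelope.

(** * Projective resolutions *)

Section Resolutions.
Variable R : pzRingType.

Definition projective (P : lmodType R) : Prop :=
  forall (M N : lmodType R) (g : {linear M -> N}) (f : {linear P -> N}),
    (forall y, exists x, g x = y) ->
    exists h : {linear P -> M}, forall p, g (h p) = f p.

Definition exact_at (U V W : lmodType R) (f : {linear U -> V})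
    (g : {linear V -> W}) : Prop :=
  forall v, g v = 0 <-> exists u, f u = v.

Definition is_submodule (V : lmodType R) (N : V -> Prop) : Prop :=
  N 0 /\ forall c u v, N u -> N v -> N (c *: u + v).

Definition superfluous (V : lmodType R) (K : V -> Prop) : Prop :=
  forall N : V -> Prop, is_submodule N ->
    (forall v, exists n u, [/\ N n, K u & v = n + u]) -> forall v, N v.

Section Complex.
Variables (P : nat -> lmodType R) (M : lmodType R).
Variables (d : forall n, {linear P n.+1 -> P n}) (eps : {linear P 0%N -> M}).

(* Exactness of [... -> P 2 -> P 1 -> P 0 -> M -> 0]; [d n] is the
   differential with source [P n.+1]. *)
Definition exact_augmented : Prop :=
  [/\ forall m, exists p, eps p = m,
      exact_at (d 0) eps &
      forall n, exact_at (d n.+1) (d n)].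

Definition projective_resolution : Prop :=
  (forall n, projective (P n)) /\ exact_augmented.

(* Minimality: every [P n] is a projective cover of its image, i.e. the kernel of
   the map out of [P n] is superfluous. *)
Definition minimal_projective_resolution : Prop :=
  [/\ projective_resolution,
      superfluous (fun p => eps p = 0) &
      forall n, superfluous (fun p => d n p = 0)].

End Complex.
End Resolutions.

(** * The quantum complete intersection [k<X, Y> / (X^a, X Y - q Y X, Y^b)] *)

Section FreeAlgebra.
Variables (k : comNzRingType) (I : choiceType).

Definition free_alg := {malg k[{fmonom I}]}.

HB.instance Definition _ := GRing.Lalgebra.on free_alg.

Fact free_alg_scalerAr (c : k) (u v : free_alg) : c *: (u * v) = u * (c *: v).
Proof.
apply/malgP => m; rewrite mcoeffZ [in LHS]mcoeffMl.
rewrite (mcoeffMlw m (fsubset_refl (msupp u)) (msuppZ_le c v)) mulr_sumr.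
apply: eq_bigr => k1 _; rewrite mulr_sumr; apply: eq_bigr => k2 _.
by rewrite mcoeffZ mulrnAr mulrCA.
Qed.

HB.instance Definition _ := GRing.Lalgebra_isAlgebra.Build k free_alg free_alg_scalerAr.

Definition free_var (i : I) : free_alg := << fmu i >>.

End FreeAlgebra.

Section QCI.
Variables (k : fieldType) (q : k) (a b : nat).

Definition free_X : free_alg k bool := free_var k false.
Definition free_Y : free_alg k bool := free_var k true.

Inductive qci_relation : free_alg k bool -> Prop :=
  | QciX : qci_relation (free_X ^+ a)
  | QciXY : qci_relation (free_X * free_Y - q *: (free_Y * free_X))
  | QciY : qci_relation (free_Y ^+ b).

Hypotheses (a_ge2 : (1 < a)%N) (b_ge2 : (1 < b)%N).

Fact qci_proper : ~ ideal_gen qci_relation 1.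
Proof.
have X0 (i : bool) : (free_var k i : {malg k[{fmonom bool}]})@_mone = 0 by rewrite mcoeffU fm1_eq1.
suff ideal0 u : ideal_gen qci_relation u -> (u : {malg k[{fmonom bool}]})@_mone = 0.
  by move=> /ideal0/eqP; rewrite rmorph1 oner_eq0.
elim=> [|l s r w Ss _ IH]; first by rewrite mcoeff0.
rewrite mcoeffD IH addr0 !rmorphM /=; suff -> : (s : {malg k[{fmonom bool}]})@_mone = 0.
  by rewrite mulr0 mul0r.
case: Ss => /=.
- by rewrite rmorphXn /= X0 expr0n eqn0Ngt (ltnW a_ge2).
- by rewrite mcoeffB mcoeffZ !rmorphM /= !X0 mulr0 mulr0 subr0.
- by rewrite rmorphXn /= X0 expr0n eqn0Ngt (ltnW b_ge2).
Qed.

Definition qci : algType k := GRing.Algebra.clone k (alg_quot qci_proper) _.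

Definition qci_x : qci := locked_with qci_x_key (alg_pi qci_proper free_X).
Definition qci_y : qci := locked_with qci_y_key (alg_pi qci_proper free_Y).

Lemma qci_x_unlock : qci_x = alg_pi qci_proper free_X.
Proof. by rewrite /qci_x unlock. Qed.

Lemma qci_y_unlock : qci_y = alg_pi qci_proper free_Y.
Proof. by rewrite /qci_y unlock. Qed.

End QCI.

(** * The complex *)

Section Complex.
Variables (k : fieldType) (q : k) (a b : nat).
Hypotheses (a_ge2 : (1 < a)%N) (b_ge2 : (1 < b)%N).

Local Notation A := (qci q a_ge2 b_ge2).
Local Notation Ae := (envelope A).
Local Notation x := (qci_x q a_ge2 b_ge2).
Local Notation y := (qci_y q a_ge2 b_ge2).
Local Notation "w ⊗ z" := (etens (w : A) (z : A)) (at level 40).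

Definition tau1 (s : nat) : Ae := escale (q ^+ s) (1 ⊗ x) - x ⊗ 1.
Definition tau2 (s : nat) : Ae := 1 ⊗ y - escale (q ^+ s) (y ⊗ 1).
Definition gamma1 (s : nat) : Ae :=
  \sum_(0 <= j < a) escale (q ^+ (j * s)) (x ^+ (a - 1 - j) ⊗ x ^+ j).
Definition gamma2 (s : nat) : Ae :=
  \sum_(0 <= j < b) escale (q ^+ (j * s)) (y ^+ j ⊗ y ^+ (b - 1 - j)).

(* Row vectors: the free left module with basis [f^n_0, ..., f^n_n]. *)
Definition res_P (n : nat) : lmodType Ae :=
  GRing.Lmodule.clone Ae 'rV[Ae]_n.+1 _.

(* The basis element [f^n_i], which is zero unless [0 <= i <= n]. *)
Definition res_f (n : nat) (i : int) : res_P n :=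
  \row_(j < n.+1) (j == i :> int)%:R.

(* [res_d_basis n i] is the image of [f^(n+1)_i] under [d_(n+1)].  For
   [i <= n.+1] all halved numbers are even and no subtraction is truncated. *)
Definition res_d_basis (n i : nat) : res_P n :=
  let t := n.+1./2 in
  if ~~ odd n.+1 then
    if ~~ odd i then
      gamma2 (a * i)./2 *: res_f n i
        + gamma1 (2 * b * t - b * i)./2 *: res_f n (i%:Z - 1)
    else
      - tau2 (a * i - a + 2)./2 *: res_f n i
        + tau1 (2 * b * t - b * i - b + 2)./2 *: res_f n (i%:Z - 1)
  else
    if ~~ odd i then
      tau2 (a * i)./2 *: res_f n i
        + gamma1 (2 * b * t - b * i + 2)./2 *: res_f n (i%:Z - 1)
    else
      - gamma2 (a * i - a + 2)./2 *: res_f n i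
        + tau1 (2 * b * t + b - b * i)./2 *: res_f n (i%:Z - 1).

Definition res_d_fun (n : nat) (v : res_P n.+1) : res_P n :=
  \sum_(i < n.+2) (v : 'rV[Ae]_n.+2) 0 i *: res_d_basis n i.

Fact res_d_is_linear n : linear (@res_d_fun n).
Proof.
move=> c u v; rewrite /res_d_fun scaler_sumr -big_split.
by apply: eq_bigr => i _ /=; rewrite !mxE scalerDl scalerA.
Qed.

HB.instance Definition _ n :=
  GRing.isLinear.Build Ae (res_P n.+1) (res_P n) _ (@res_d_fun n)
    (@res_d_is_linear n).

Definition res_d (n : nat) : {linear res_P n.+1 -> res_P n} :=
  GRing.Linear.clone Ae _ _ _ (@res_d_fun n) _.

Lemma res_dE n (i : 'I_n.+2) : res_d n (res_f n.+1 i) = res_d_basis n i.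
Proof.
change (res_d_fun (res_f n.+1 i) = res_d_basis n i).
rewrite /res_d_fun (bigD1 i) // big1 /= => [|j ne_ji].
  by rewrite addr0 [X in X *: _]mxE eqxx scale1r.
rewrite [X in X *: _]mxE eqz_nat.
by rewrite (negbTE (ne_ji : (j : nat) != i)) scale0r.
Qed.

Definition res_mu_fun (v : res_P 0) : bimod A :=
  envelope_mul ((v : 'rV[Ae]_1) 0 0).

Fact res_mu_is_linear : linear res_mu_fun.
Proof.
by move=> c u v; rewrite /res_mu_fun !mxE envelope_mulD envelope_mulM.
Qed.

HB.instance Definition _ :=
  GRing.isLinear.Build Ae (res_P 0) (bimod A) _ res_mu_fun res_mu_is_linear.

Definition res_mu : {linear res_P 0 -> bimod A} :=
  GRing.Linear.clone Ae _ _ _ res_mu_fun _.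

End Complex.

(* Main.v *)
(* The complex is the total complex of a bicomplex.  Writing [R] for the enveloping
   algebra, [xl, xr, yl, yr] for [x⊗1, 1⊗x, y⊗1, 1⊗y] and [f^n_i] for the generator in
   position [(i, n - i)], the horizontal maps are right multiplication by
   [Q^s xr - xl] or by the norm [\sum xl^(a-1-j) (Q^s xr)^j], the vertical ones are
   their analogues in [yl, yr], and the twists [s] are exactly what makes the squares
   commute up to sign.  As a right module over [k[xl, xr]], [R] is free, so every row
   is a copy of the periodic resolution and is exact away from column 0.  There, [R]
   modulo [Q^s xr - xl] is identified with [A⊗k[y]], on which the vertical maps again
   form the periodic resolution, with [A] as cokernel; a diagram chase column by
   column concludes.  Linear independence rests on the functionals on the free algebra
   that read off the coefficient of [x^i y^j] in a word after sorting it.  For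
   minimality, all coefficients of the differentials lie in the ideal generated by the
   nilpotent normal elements [xl, xr, yl, yr], and Nakayama's lemma applies to one
   such generator at a time. *)

From HB Require Import structures.
Require Import Defs.
From mathcomp Require Import all_boot all_algebra.
From mathcomp Require Import finmap monalg generic_quotient boolp zify.

Set Implicit Arguments.
Unset Strict Implicit.
Unset Printing Implicit Defensive.

Import GRing.Theory.
Local Open Scope ring_scope.

(** * Truncated polynomials *)

Section TruncatedPolynomials.
Variables (R : pzRingType) (C : R -> Prop) (u v : R) (n : nat).
Hypothesis CB : forall c c', C c -> C c' -> C (c - c').
Hypothesis C_mulu : forall c, C c -> C (c * u).
Hypothesis comm_uv : GRing.comm u v.
Hypotheses (n_gt0 : (0 < n)%N) (un0 : u ^+ n = 0) (vn0 : v ^+ n = 0).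
Hypothesis free_v : forall c : nat -> R, (forall i, C (c i)) ->
  \sum_(i < n) c i * v ^+ i = 0 -> forall i, (i < n)%N -> c i = 0.

(** For commuting [u] and [v], the quotient of [v ^+ n - u ^+ n] by [v - u]. *)
Definition trunc_norm : R := \sum_(i < n) u ^+ (n.-1 - i) * v ^+ i.

Lemma trunc_normMl : (v - u) * trunc_norm = 0.
Proof. by rewrite -opprB mulNr -subrXX_comm // un0 vn0 subr0 oppr0. Qed.

Lemma trunc_normMr : trunc_norm * (v - u) = 0.
Proof.
suff -> : GRing.comm trunc_norm (v - u) by apply: trunc_normMl.
apply/commr_sym/commr_sum => i _; apply/commrM/commrX; last first.
  by apply/commr_sym/commrB => //; apply/commr_sym.
by apply/commrX/commr_sym/commrB.
Qed.

Lemma trunc_mulu_exp c i : C c -> C (c * u ^+ i).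
Proof.
by move=> Cc; elim: i => [|i IH]; rewrite ?mulr1 // exprSr mulrA; apply: C_mulu.
Qed.

(** The top coefficient of [c * trunc_norm], at [v ^+ n.-1], is [c] itself. *)
Lemma trunc_norm_eq0 c : C c -> c * trunc_norm = 0 -> c = 0.
Proof.
move=> Cc; rewrite mulr_sumr => c0.
rewrite -[c]mulr1 -(expr0 u) -(subnn n.-1).
apply: (free_v (c := fun i => c * u ^+ (n.-1 - i))); last by rewrite ltn_predL.
  by move=> i; apply: trunc_mulu_exp.
by rewrite -[RHS]c0; apply: eq_bigr => i _; rewrite mulrA.
Qed.

Lemma trunc_diff_eq0 c w : C c -> c = w * (v - u) -> c = 0.
Proof.
by move=> Cc cE; apply: trunc_norm_eq0 => //; rewrite cE -mulrA trunc_normMl mulr0.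
Qed.

(** Modulo left multiples of [v - u], each [v] may be traded for [u], which [C] absorbs. *)
Lemma trunc_mod (c : nat -> R) : (forall i, C (c i)) ->
  exists w e, C e /\ \sum_(i < n) c i * v ^+ i = w * (v - u) + e.
Proof.
move=> Cc; have CN e : C e -> C (- e).
  by move=> Ce; rewrite -[- e]add0r -(subrr e); do ![apply: CB].
have C0 : C 0 by rewrite -(subrr (c 0)); apply: CB.
have mon i : forall e, C e -> exists w e', C e' /\ e * v ^+ i = w * (v - u) + e'.
  elim: i => [|i IH] e Ce; first by exists 0, e; rewrite mul0r add0r mulr1.
  have [w [e' [Ce' eE]]] := IH _ (C_mulu Ce).
  (* [e * v ^+ i.+1 = e * v ^+ i * (v - u) + e * u * v ^+ i], and the induction hypothesis has been
     applied to [e * u]. *)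
  exists (e * v ^+ i + w), e'; split => //.
  rewrite mulrDl -addrA -eE mulrBr -!mulrA (commrX _ comm_uv) -exprSr.
  by rewrite subrK.
elim: n => [|m [w [e [Ce eE]]]]; first by exists 0, 0; rewrite big_ord0 mul0r addr0.
have [w' [e' [Ce' e'E]]] := mon m _ (Cc m).
exists (w + w'), (e + e'); split; last by rewrite big_ord_recr /= eE e'E mulrDl addrACA.
by rewrite -[e']opprK; apply: CB => //; apply: CN.
Qed.

(** Only the remainder in [C] survives multiplication by the norm, so [trunc_norm_eq0] forces it to
    vanish. *)
Lemma trunc_ker_norm (c : nat -> R) : (forall i, C (c i)) ->
  (\sum_(i < n) c i * v ^+ i) * trunc_norm = 0 ->
  exists w, \sum_(i < n) c i * v ^+ i = w * (v - u).
Proof.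
move=> Cc; have [w [e [Ce ->]]] := trunc_mod Cc.
rewrite mulrDl -mulrA trunc_normMl mulr0 add0r => /(trunc_norm_eq0 Ce) ->.
by exists w; rewrite addr0.
Qed.

(** Comparing coefficients gives [c i = c i.+1 * u], so the top coefficient [c n.-1] determines all
    others and is the quotient. *)
Lemma trunc_ker_diff (c : nat -> R) : (forall i, C (c i)) ->
  (\sum_(i < n) c i * v ^+ i) * (v - u) = 0 ->
  exists w, \sum_(i < n) c i * v ^+ i = w * trunc_norm.
Proof.
move=> Cc cvu; exists (c n.-1).
(* [e i] is the coefficient of [v ^+ i] in the product: nothing is shifted into index 0, and the
   term shifted out at the top dies because [v ^+ n = 0]. *)
pose e i := (if i is j.+1 then c j else 0) - c i * u.
have C0 : C 0 by rewrite -(subrr (c 0)); apply: CB.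
have e0 i : (i < n)%N -> e i = 0.
  apply: free_v => [j|]; first by apply: CB; [case: j | apply: C_mulu].
  rewrite -[RHS]cvu mulrBr !mulr_suml -(prednK n_gt0).
  rewrite /e; under eq_bigr => j _ do rewrite mulrBl.
  rewrite big_split /= sumrN; congr (_ - _); last first.
    by apply: eq_bigr => j _; rewrite -!mulrA (commrX _ comm_uv).
  rewrite big_ord_recl mul0r add0r [RHS]big_ord_recr /=.
  rewrite -[X in _ = _ + X]mulrA -exprSr prednK // vn0 mulr0 addr0.
  by apply: eq_bigr => j _; rewrite -mulrA -exprSr.
have cE j : (j < n)%N -> c (n.-1 - j)%N = c n.-1 * u ^+ j.
  elim: j => [|j IH] jn; first by rewrite subn0 mulr1.
  have jn' : (j < n.-1)%N by rewrite -ltnS prednK.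
  have lt_n : ((n.-1 - j.+1).+1 < n)%N.
    by rewrite subnSK // -[X in (_ < X)%N](prednK n_gt0) ltnS leq_subr.
  have /subr0_eq /= -> := e0 _ lt_n.
  by rewrite subnSK // IH 1?ltnW // exprSr mulrA.
rewrite mulr_sumr; apply: eq_bigr => i _; rewrite mulrA -cE; last first.
  by rewrite -[X in (_ < X)%N](prednK n_gt0) ltnS leq_subr.
by rewrite subKn // -ltnS prednK.
Qed.

End TruncatedPolynomials.

(** * The horizontal and vertical differentials *)

(* The degree in one variable of the [i]-th generator of the periodic
   resolution of [k[x]/(x^n)]. *)
Definition per_deg (n i : nat) : nat := (n * i./2 + odd i)%N.

(** The degree of the differential leaving the [i]-th generator: a difference for odd [i], a norm
    for even [i]. *)
Definition per_step (n i : nat) : nat := if odd i then 1 else n.-1.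

Lemma per_degS n i : (0 < n)%N -> per_deg n i.+1 = (per_deg n i + per_step n i.+1)%N.
Proof.
move=> n_gt0; rewrite /per_deg /per_step /= uphalf_half.
case: (odd i) => /=; last by rewrite add0n !addn0.
by rewrite !addn0 mulnDr muln1 addnC -addnA [(1 + _)%N]add1n prednK.
Qed.

Section QuantumPlane.
Variables (R : pzRingType) (Q xl xr yl yr : R) (a b : nat).
Hypothesis Q_comm : forall w, GRing.comm Q w.
Hypotheses (xl_yl : xl * yl = Q * (yl * xl)) (yr_xr : yr * xr = Q * (xr * yr)).
Hypotheses (xl_yr : GRing.comm xl yr) (xr_yl : GRing.comm xr yl).
Hypotheses (xl_xr : GRing.comm xl xr) (yl_yr : GRing.comm yl yr).
Hypotheses (a_gt0 : (0 < a)%N) (b_gt0 : (0 < b)%N).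
Hypotheses (xla : xl ^+ a = 0) (xra : xr ^+ a = 0).
Hypotheses (ylb : yl ^+ b = 0) (yrb : yr ^+ b = 0).

Definition xdiff s : R := Q ^+ s * xr - xl.
Definition ydiff s : R := yr - Q ^+ s * yl.
Definition xnorm s : R := trunc_norm xl (Q ^+ s * xr) a.
Definition ynorm s : R := trunc_norm (Q ^+ s * yl) yr b.

Definition xper i s : R := if odd i then xdiff s else xnorm s.
Definition yper i s : R := if odd i then ydiff s else ynorm s.

Lemma QX_comm s w : GRing.comm (Q ^+ s) w.
Proof. exact/commr_sym/commrX/commr_sym. Qed.

Lemma xl_Qxr s : GRing.comm xl (Q ^+ s * xr).
Proof. by apply: commrM => //; apply/commr_sym/QX_comm. Qed.

Lemma Qyl_yr s : GRing.comm (Q ^+ s * yl) yr.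
Proof. by apply/commr_sym/commrM; [apply/commr_sym/QX_comm | apply/commr_sym]. Qed.

Lemma Qxr_nilp s : (Q ^+ s * xr) ^+ a = 0.
Proof. by rewrite exprMn_comm ?xra ?mulr0 //; apply: QX_comm. Qed.

Lemma Qyl_nilp s : (Q ^+ s * yl) ^+ b = 0.
Proof. by rewrite exprMn_comm ?ylb ?mulr0 //; apply: QX_comm. Qed.

Lemma xper_xper i s : xper i.+1 s * xper i s = 0.
Proof.
rewrite /xper /=; case: (odd i) => /=; last exact: (trunc_normMl (xl_Qxr s) xla (Qxr_nilp s)).
exact: (trunc_normMr (xl_Qxr s) xla (Qxr_nilp s)).
Qed.

Lemma yper_yper i s : yper i.+1 s * yper i s = 0.
Proof.
rewrite /yper /=; case: (odd i) => /=; last exact: (trunc_normMl (Qyl_yr s) (Qyl_nilp s) yrb).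
exact: (trunc_normMr (Qyl_yr s) (Qyl_nilp s) yrb).
Qed.

Lemma expr_shift (u v w : R) n : u * w = w * v -> u ^+ n * w = w * v ^+ n.
Proof.
move=> uw; elim: n => [|n IH]; first by rewrite mul1r mulr1.
by rewrite exprSr -mulrA uw mulrA IH -mulrA -exprSr.
Qed.

(** Moving [yr] across [xr] uses up one factor [Q] of the twist, while [xl] commutes with [yr]. *)
Lemma xper_yr i s : xper i s.+1 * yr = yr * xper i s.
Proof.
have xr_yr : Q ^+ s.+1 * xr * yr = yr * (Q ^+ s * xr).
  by rewrite [RHS]mulrA -QX_comm -[RHS]mulrA yr_xr !mulrA -exprSr.
rewrite /xper; case: (odd i); first by rewrite mulrBl mulrBr xr_yr xl_yr.
rewrite mulr_suml mulr_sumr; apply: eq_bigr => j _.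
rewrite -mulrA (expr_shift _ xr_yr) !mulrA; congr (_ * _).
exact: expr_shift.
Qed.

(** Moving [yl] across multiplies both [xl] and [Q ^+ s * xr] by [Q], and [xper i] is homogeneous of
    degree [per_step a i] in these two. *)
Lemma xper_yl i s : xper i s.+1 * yl = Q ^+ per_step a i * (yl * xper i s).
Proof.
have xl_yl' : xl * yl = yl * (Q * xl) by rewrite xl_yl mulrA Q_comm mulrA.
have xr_yl' : Q ^+ s.+1 * xr * yl = yl * (Q * (Q ^+ s * xr)).
  by rewrite -mulrA xr_yl mulrA QX_comm exprS !mulrA.
rewrite /xper /per_step; case: (odd i).
  have swap w : Q * (yl * w) = yl * (Q * w) by rewrite !mulrA Q_comm.
  by rewrite mulrBl expr1 mulrBr mulrBr !swap -xr_yl' -xl_yl'.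
rewrite mulr_suml !mulr_sumr; apply: eq_bigr => j _.
rewrite -mulrA (expr_shift _ xr_yl') mulrA (expr_shift _ xl_yl') -!mulrA.
rewrite [RHS]mulrA (QX_comm a.-1) -[RHS]mulrA; congr (yl * _).
rewrite !(exprMn_comm _ (Q_comm _)) -mulrA [X in _ * X]mulrA -(QX_comm j).
by rewrite -[X in _ * X]mulrA mulrA -exprD subnK // -ltnS prednK.
Qed.

Lemma xper_yrX i s n : xper i (s + n) * yr ^+ n = yr ^+ n * xper i s.
Proof.
elim: n => [|n IH]; first by rewrite addn0 mul1r mulr1.
by rewrite addnS exprS mulrA xper_yr -mulrA IH mulrA.
Qed.

Lemma xper_ylX i s e n :
  xper i (s + n) * (Q ^+ e * yl) ^+ n =
    (Q ^+ (e + per_step a i) * yl) ^+ n * xper i s.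
Proof.
elim: n => [|n IH]; first by rewrite addn0 mul1r mulr1.
have step t : xper i t.+1 * (Q ^+ e * yl) = Q ^+ (e + per_step a i) * yl * xper i t.
  by rewrite mulrA -(QX_comm e) -mulrA xper_yl !mulrA exprD.
by rewrite addnS exprS mulrA step -mulrA IH mulrA -exprS.
Qed.

(** Each of the [per_step b m] letters [yl], [yr] in a monomial of [yper m] lowers the twist of
    [xper] by one, and each [yl] picks up [Q ^+ per_step a i], which raises the twist of [yper]. *)
Lemma xper_yper i m s e :
  xper i (s + per_step b m) * yper m e = yper m (e + per_step a i) * xper i s.
Proof.
rewrite {1}/per_step /yper; case: (odd m).
  rewrite mulrBr mulrBl addn1 xper_yr; congr (_ - _).
  by have := xper_ylX i s e 1; rewrite !expr1 addn1.
rewrite mulr_sumr mulr_suml; apply: eq_bigr => j _.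
have jb : (j <= b.-1)%N by rewrite -ltnS prednK.
(* The degree [b.-1] splits into [b.-1 - j] letters [yl], crossed first, and [j] letters [yr]. *)
rewrite -{1}(subnKC jb) [(j + _)%N]addnC [LHS]mulrA.
have -> : (s + (b.-1 - j + j) = (s + j) + (b.-1 - j))%N by rewrite -addnA [(j + _)%N]addnC.
by rewrite xper_ylX -!mulrA xper_yrX.
Qed.

(** * Exactness of the rows, and of column 0 modulo the rows *)

Variables (Q' : R) (C : R -> Prop).
Hypotheses (QQ' : Q * Q' = 1) (Q'_comm : forall w, GRing.comm Q' w).
Hypothesis CB : forall c c', C c -> C c' -> C (c - c').
Hypotheses (C_xl : forall c, C c -> C (c * xl)) (C_yl : forall c, C c -> C (c * yl)).
Hypotheses (C_Q : forall c, C c -> C (c * Q)) (C_Q' : forall c, C c -> C (c * Q')).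
Hypothesis C_span : forall w, exists2 c : nat -> nat -> R, forall i j, C (c i j) &
  w = \sum_(i < a) (\sum_(j < b) c i j * yr ^+ j) * xr ^+ i.
Hypothesis C_free : forall c : nat -> nat -> R, (forall i j, C (c i j)) ->
  \sum_(i < a) (\sum_(j < b) c i j * yr ^+ j) * xr ^+ i = 0 ->
  forall i j, (i < a)%N -> (j < b)%N -> c i j = 0.

(** Two layers of truncated polynomials: those in [yr] over [C] form [D], and those in [xr] over [D]
    fill [R]. *)
Let D (w : R) := exists2 c : nat -> R, forall j, C (c j) &
  w = \sum_(j < b) c j * yr ^+ j.

Let C0 : C 0.
Proof. by have [c Cc _] := C_span 0; rewrite -(subrr (c 0 0)); apply: CB. Qed.

Let C_yr_free (c : nat -> R) : (forall j, C (c j)) ->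
  \sum_(j < b) c j * yr ^+ j = 0 -> forall j, (j < b)%N -> c j = 0.
Proof.
(* A family independent of [i] makes every inner sum vanish. *)
move=> Cc c0 j jb; apply: (C_free (c := fun i j => c j) _ _ a_gt0 jb) => //.
by rewrite big1 // => i _; rewrite c0 mul0r.
Qed.

Let DB w w' : D w -> D w' -> D (w - w').
Proof.
move=> [c Cc ->] [c' Cc' ->]; exists (fun j => c j - c' j) => [j|]; first exact: CB.
by rewrite -sumrB; apply: eq_bigr => j _; rewrite mulrBl.
Qed.

Let D_mul z w : (forall c, C c -> C (c * z)) -> GRing.comm z yr -> D w -> D (w * z).
Proof.
move=> Cz z_yr [c Cc ->]; exists (fun j => c j * z) => [j|]; first exact: Cz.
rewrite mulr_suml; apply: eq_bigr => j _; rewrite -!mulrA; congr (_ * _).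
exact/commr_sym/commrX.
Qed.

Let D_xl w : D w -> D (w * xl). Proof. exact: D_mul. Qed.
Let D_yl w : D w -> D (w * yl). Proof. exact: D_mul. Qed.

Let D_QX w n : D w -> D (w * Q ^+ n).
Proof.
move=> Dw; elim: n => [|n IH]; rewrite ?mulr1 // exprSr mulrA.
exact: D_mul.
Qed.

Let D_Q'X w n : D w -> D (w * Q' ^+ n).
Proof.
move=> Dw; elim: n => [|n IH]; rewrite ?mulr1 // exprSr mulrA.
exact: D_mul.
Qed.

Let D_yr w : D w -> D (w * yr).
Proof.
move=> [c Cc ->]; exists (fun j => if j is j'.+1 then c j' else 0); first by case.
rewrite -(prednK b_gt0) mulr_suml big_ord_recr [RHS]big_ord_recl /= mul0r add0r.
rewrite -mulrA -exprSr prednK // yrb mulr0 addr0; apply: eq_bigr => j _.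
by rewrite -mulrA -exprSr.
Qed.

Let QQ'X n : Q ^+ n * Q' ^+ n = 1.
Proof. by rewrite -exprMn_comm // QQ' expr1n. Qed.

(** As [Q] is central and invertible, coefficients absorb [Q ^+ (s * i)], and the twisted powers are
    as good a basis as those of [xr]. *)
Let xr_free s (c : nat -> R) : (forall i, D (c i)) ->
  \sum_(i < a) c i * (Q ^+ s * xr) ^+ i = 0 -> forall i, (i < a)%N -> c i = 0.
Proof.
move=> Dc c0 i ia; have /choice[e eP] j : exists e : nat -> R, (forall j, C (e j)) /\
    c j * Q ^+ (s * j) = \sum_(j < b) e j * yr ^+ j.
  by have [e] := D_QX (s * j) (Dc j); exists e.
rewrite -[c i]mulr1 -(QQ'X (s * i)) mulrA (eP i).2 big1 ?mul0r // => j _.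
rewrite (C_free (c := e)) ?mul0r => // [i' j'|]; first exact: (eP i').1.
rewrite -[RHS]c0; apply: eq_bigr => i' _; rewrite -(eP i').2 -mulrA exprM.
by rewrite -exprMn_comm //; apply: QX_comm.
Qed.

Let xr_span s w : exists2 c : nat -> R, forall i, D (c i) &
  w = \sum_(i < a) c i * (Q ^+ s * xr) ^+ i.
Proof.
have [c Cc wE] := C_span w.
exists (fun i => (\sum_(j < b) c i j * yr ^+ j) * Q' ^+ (s * i)) => [i|].
  by apply: D_Q'X; exists (c i).
rewrite wE; apply: eq_bigr => i _; rewrite -mulrA; congr (_ * _).
rewrite (exprMn_comm _ (@QX_comm s xr)) -exprM mulrA.
by rewrite (commr_sym (QX_comm _ _)) QQ'X mul1r.
Qed.

Lemma xper_exact i s w : w * xper i s = 0 -> exists w', w = w' * xper i.+1 s.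
Proof.
have [c Dc ->] := xr_span s w; rewrite /xper /=; case: (odd i) => /=.
  exact: (trunc_ker_diff DB D_xl (xl_Qxr s) a_gt0 (Qxr_nilp s) (@xr_free s) Dc).
exact: (trunc_ker_norm DB D_xl (xl_Qxr s) a_gt0 xla (Qxr_nilp s) (@xr_free s) Dc).
Qed.

Lemma modulo_xdiff s w : exists w' c, D c /\ w = w' * xdiff s + c.
Proof.
by have [c Dc ->] := xr_span s w; exact: (trunc_mod a DB D_xl (xl_Qxr s) Dc).
Qed.

Lemma modulo_ydiff w : D w -> exists w' c, C c /\ w = w' * ydiff 0 + c.
Proof.
by move=> [c Cc ->]; rewrite /ydiff mul1r; exact: (trunc_mod b CB C_yl yl_yr Cc).
Qed.

Lemma D_yper m w : D w -> D (w * yper m 0).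
Proof.
have D0 : D 0.
  by exists (fun=> 0) => //; rewrite big1 // => j _; rewrite mul0r.
have D_ylX n e : D e -> D (e * yl ^+ n).
  by move=> De; elim: n => [|n IH]; rewrite ?mulr1 // exprSr mulrA; apply: D_yl.
have D_yrX n e : D e -> D (e * yr ^+ n).
  by move=> De; elim: n => [|n IH]; rewrite ?mulr1 // exprSr mulrA; apply: D_yr.
move=> Dw; rewrite /yper; case: (odd m).
  by rewrite /ydiff mul1r mulrBr; apply: DB; [apply: D_yr | apply: D_yl].
rewrite /ynorm /trunc_norm mul1r mulr_sumr.
elim/big_rec: _ => // i e _ De; rewrite mulrA -[e]opprK; apply: DB.
  by apply/D_yrX/D_ylX.
by rewrite -[- e]add0r; apply: DB.
Qed.

(** Modulo multiples of [xdiff], [w] has a representative [c] in [D]. Then [c * yper m 0] lies in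
    [D] and is a multiple of [xdiff s], hence is zero, and the truncated polynomial lemmas over [C]
    apply to [c]. *)
Lemma yper_coker_exact m s w w' : w * yper m 0 = w' * xdiff s ->
  exists w0 w1, w = w0 * yper m.+1 0 + w1 * xdiff (s + per_step b m).
Proof.
have [w1 [c [Dc ->]]] := modulo_xdiff (s + per_step b m) w.
rewrite mulrDl => wE; suff [w0 ->] : exists w0, c = w0 * yper m.+1 0.
  by exists w0, w1; rewrite addrC.
(* [xdiff (s + per_step b m)] crosses [yper m 0] by [xper_yper] and comes out as [xdiff s]. *)
have : c * yper m 0 = (w' - w1 * yper m (0 + per_step a 1)) * xdiff s.
  have xy := xper_yper 1 m s 0; rewrite /xper /= in xy.
  by rewrite mulrBl -[w1 * _ * _]mulrA -xy mulrA -wE addrC addKr.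
move=> /(trunc_diff_eq0 D_xl (xl_Qxr s) a_gt0 xla (Qxr_nilp s) (@xr_free s)).
move=> /(_ (D_yper _ Dc)); have [e Ce ->] := Dc.
rewrite /yper /=; case: (odd m) => /=; rewrite /ydiff /ynorm mul1r.
  exact: (trunc_ker_diff CB C_yl yl_yr b_gt0 yrb C_yr_free Ce).
exact: (trunc_ker_norm CB C_yl yl_yr b_gt0 ylb yrb C_yr_free Ce).
Qed.

Lemma modulo_diffs w : exists w0 w1 c,
  C c /\ w = w0 * ydiff 0 + w1 * xdiff 0 + c.
Proof.
have [w1 [e [De ->]]] := modulo_xdiff 0 w.
have [w0 [c [Cc ->]]] := modulo_ydiff De.
by exists w0, w1, c; split => //; rewrite addrA [X in X + _]addrC.
Qed.

End QuantumPlane.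

(** * The total complex *)

(* [V i m] and [H i m] are the vertical and horizontal differentials leaving the
   free rank one module in position [(i, m)], acting by right multiplication. *)
Section TotalComplex.
Variables (R : pzRingType) (V H : nat -> nat -> R).

(** Position [(j, n - j)] is reached vertically from [(j, n.+1 - j)] and horizontally from
    [(j.+1, n - j)]. *)
Definition tot_d n (v : 'rV[R]_n.+2) : 'rV[R]_n.+1 :=
  \row_(j < n.+1) (v 0 (inord j) * V j (n.+1 - j)
                     + v 0 (inord j.+1) * H j.+1 (n - j)).

Lemma tot_dE n (v : 'rV[R]_n.+2) j : (j <= n)%N -> tot_d v 0 (inord j) =
  v 0 (inord j) * V j (n.+1 - j) + v 0 (inord j.+1) * H j.+1 (n - j).
Proof. by move=> jn; rewrite mxE inordK. Qed.

Lemma row_inordP n (v w : 'rV[R]_n.+1) :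
  (forall j, (j <= n)%N -> v 0 (inord j) = w 0 (inord j)) -> v = w.
Proof.
move=> vw; apply/rowP => j; rewrite -[j]inord_val; apply: vw.
by rewrite -ltnS.
Qed.

Lemma tot_dD n (u v : 'rV[R]_n.+2) : tot_d (u + v) = tot_d u + tot_d v.
Proof. by apply/rowP => j; rewrite !mxE !mulrDl addrACA. Qed.

Lemma tot_dB n (u v : 'rV[R]_n.+2) : tot_d (u - v) = tot_d u - tot_d v.
Proof. by apply/eqP; rewrite -subr_eq opprK -tot_dD subrK. Qed.

Hypothesis VV : forall i m, V i m.+1 * V i m = 0.
Hypothesis HH : forall i m, H i.+1 m * H i m = 0.
Hypothesis VH : forall i m, V i.+1 m.+1 * H i.+1 m + H i.+1 m.+1 * V i m.+1 = 0.
Hypothesis H_exact : forall i m w, w * H i.+1 m = 0 ->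
  exists w', w = w' * H i.+2 m.
Hypothesis V_coker_exact : forall m w w', w * V 0 m.+1 = w' * H 1 m ->
  exists w0 w1, w = w0 * V 0 m.+2 + w1 * H 1 m.+1.

Lemma tot_dd n (v : 'rV[R]_n.+3) : tot_d (tot_d v) = 0.
Proof.
apply: row_inordP => j jn; rewrite !tot_dE ?mxE //; last by rewrite ltnW.
rewrite !subSS subSn; last by rewrite ltnW.
rewrite subSn // !mulrDl -!mulrA VV HH !mulr0 add0r addr0.
by rewrite -mulrDr addrC VH mulr0.
Qed.

(* Row exactness lets us kill a cycle one column at a time. *)
Lemma tot_exact_above n (v : 'rV[R]_n.+2) i : tot_d v = 0 ->
  (forall j, (j <= i)%N -> v 0 (inord j) = 0) -> exists u, tot_d u = v.
Proof.
(* Induction on the number of columns still to be cleared. *)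
move: {2}(n.+1 - i)%N (erefl (n.+1 - i)%N) => m mE.
elim: m i v mE => [|m IH] i v mE dv0 v0.
  exists 0; apply: row_inordP => j jn; rewrite v0; last first.
    by apply: leq_trans jn _; rewrite -subn_eq0 mE.
  by rewrite tot_dE // !mxE !mul0r addr0.
have i_lt : (i < n.+1)%N by rewrite -subn_gt0 mE.
have i_le : (i <= n)%N by [].
have := congr1 (fun v : 'rV[R]_n.+1 => v 0 (inord i)) dv0.
rewrite tot_dE // v0 // mul0r add0r mxE => /H_exact[w wE].
(* Placed in column [i.+2], [w] maps horizontally onto entry [i.+1] of [v] and vertically into
   column [i.+2], so the cleared columns stay zero. *)
pose u : 'rV[R]_n.+3 := \row_k (if k == i.+2 :> nat then w else 0).
have uE k : (k <= n.+2)%N -> u 0 (inord k) = if k == i.+2 then w else 0.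
  by move=> kn; rewrite mxE inordK.
have [||j ji|u' u'E] := IH i.+1 (v - tot_d u).
- by rewrite subnS mE.
- by rewrite tot_dB dv0 tot_dd subr0.
- have jn : (j <= n.+1)%N by apply: leq_trans ji _.
  rewrite 2!mxE tot_dE // !uE ?(leq_trans jn) // eqSS.
  have [->|ne_ji] := eqVneq j i.+1.
    by rewrite [i.+1 == _]eqn_leq ltnn andbF mul0r add0r subSS wE subrr.
  rewrite mul0r addr0 [j == _]eqn_leq [(i.+2 <= j)%N]leqNgt ltnS ji andbF mul0r.
  by rewrite v0 ?subr0 // -ltnS ltn_neqAle ne_ji.
by exists (u' + u); rewrite tot_dD u'E subrK.
Qed.

(** Column 0 has no row exactness to rely on. The cycle condition there says that entry 0 is killed
    by [V] modulo the image of [H]; the cokernel hypothesis then lets it be cleared, after which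
    [tot_exact_above] takes over. *)
Lemma tot_exact n (v : 'rV[R]_n.+2) : tot_d v = 0 <-> exists u, tot_d u = v.
Proof.
split=> [dv0|[u <-]]; last exact: tot_dd.
have := congr1 (fun v : 'rV[R]_n.+1 => v 0 (inord 0)) dv0.
rewrite tot_dE // mxE !subn0 => /eqP; rewrite addr_eq0 -mulNr => /eqP.
move=> /V_coker_exact[w0 [w1 wE]].
pose u : 'rV[R]_n.+3 := \row_k (if k == 0 :> nat then w0
                                else if k == 1 :> nat then w1 else 0).
have [||u' u'E] := @tot_exact_above n (v - tot_d u) 0.
- by rewrite tot_dB dv0 tot_dd subr0.
- move=> j; rewrite leqn0 => /eqP->.
  rewrite 2!mxE tot_dE // [u _ _]mxE inordK // [u _ _]mxE inordK //.
  by rewrite !subn0 wE subrr.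
by exists (u' + u); rewrite tot_dD u'E subrK.
Qed.

End TotalComplex.

(** * Free modules and superfluous submodules *)

Section FreeModules.
Variable R : pzRingType.

Lemma projective_rV n : projective ('rV[R]_n : lmodType R).
Proof.
move=> M N g f g_surj.
have /choice[m mE] (i : 'I_n) : exists x, g x = f (delta_mx 0 i) by [].
pose h (p : 'rV[R]_n) := \sum_i p 0 i *: m i.
have h_lin : linear h.
  move=> c u v; rewrite /h scaler_sumr -big_split; apply: eq_bigr => i _ /=.
  by rewrite !mxE scalerDl scalerA.
pose hL : {linear 'rV[R]_n -> M} := HB.pack h (GRing.isLinear.Build R _ _ _ h h_lin).
exists hL => p; rewrite [in RHS](row_sum_delta p) !linear_sum /=.
by apply: eq_bigr => i _; rewrite !linearZ mE.
Qed.

(** This side of normality is the one that makes [g *: V] a submodule of a left module [V]. *)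
Definition normal_elt (g : R) : Prop := forall c, exists c', c * g = g * c'.

Fixpoint scaled_sum (V : lmodType R) (gs : seq R) (v : V) : Prop :=
  if gs is g :: gs' then exists u w, scaled_sum gs' w /\ v = g *: u + w else v = 0.

Section ScaledSum.
Variables (V : lmodType R).
Implicit Types (gs : seq R) (u v w : V).

Lemma scaled_sum0 gs : scaled_sum gs (0 : V).
Proof.
by elim: gs => //= g gs IH; exists 0, 0; rewrite scaler0 addr0.
Qed.

Lemma scaled_sum_mem gs g v : g \in gs -> scaled_sum gs (g *: v).
Proof.
elim: gs => //= g' gs IH; rewrite inE => /predU1P[->|/IH gv].
  by exists v, 0; split; [exact: scaled_sum0 | rewrite addr0].
by exists 0, (g *: v); rewrite scaler0 add0r.
Qed.

Lemma scaled_sum_submodule gs : (forall g, g \in gs -> normal_elt g) ->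
  is_submodule (@scaled_sum V gs).
Proof.
move=> gsN; split; first exact: scaled_sum0.
elim: gs gsN => [|g gs IH] gsN c u v /=; first by move=> -> ->; rewrite scaler0 addr0.
move=> [u1 [u2 [Su ->]]] [v1 [v2 [Sv ->]]].
have [c' cE] := gsN g (mem_head _ _) c.
exists (c' *: u1 + v1), (c *: u2 + v2); split.
  by apply: IH => // g' g'S; apply: gsN; rewrite inE g'S orbT.
by rewrite !scalerDr !scalerA cE addrACA.
Qed.

Lemma superfluous_sub (K K' : V -> Prop) :
  (forall v, K v -> K' v) -> superfluous K' -> superfluous K.
Proof.
move=> KK' K'sup N Nsub NK; apply: K'sup => // v.
have [n [u [Nn Ku ->]]] := NK v; exists n, u; split => //; exact: KK'.
Qed.

(** Nakayama for the head [g]: substituting the decomposition of [V] into its own summand [g *: V]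
    raises the power of [g] until it vanishes, leaving the shorter list to the induction
    hypothesis. *)
Lemma superfluous_scaled_sum gs :
  (forall g, g \in gs -> normal_elt g /\ exists n, g ^+ n = 0) ->
  superfluous (@scaled_sum V gs).
Proof.
elim: gs => [|g gs IH] gsP N Nsub NK.
  by move=> v; have [n [u [Nn -> ->]]] := NK v; rewrite addr0.
have [N0 Nlin] := Nsub.
have gsP' g' : g' \in gs -> normal_elt g' /\ exists n, g' ^+ n = 0.
  by move=> g'S; apply: gsP; rewrite inE g'S orbT.
apply: IH => // v; have [_ [n gn]] := gsP g (mem_head _ _).
have [S0 Slin] := scaled_sum_submodule (fun g' g'S => (gsP' g' g'S).1).
suff key m : exists u w z, [/\ N u, scaled_sum gs w & v = u + w + g ^+ m *: z].
  by have [u [w [z [Nu Sw ->]]]] := key n; exists u, w; rewrite gn scale0r addr0.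
elim: m => [|m [u [w [z [Nu Sw vE]]]]].
  by exists 0, 0, v; split=> //; rewrite !add0r scale1r.
have [u' [_ [Nu' [z' [w' [Sw' ->]]] zE]]] := NK z.
exists (g ^+ m *: u' + u), (g ^+ m *: w' + w), z'; split; [exact: Nlin|exact: Slin|].
rewrite vE zE !scalerDr scalerA -exprSr [_ + g ^+ m *: w']addrC.
by rewrite (addrA (g ^+ m *: u')) (addrA (u + w)) (addrACA u) (addrC u) (addrC w).
Qed.

End ScaledSum.

Lemma scaled_sum_row gs n (v : 'rV[R]_n) :
  (forall j, scaled_sum gs (v 0 j : R^o)) -> scaled_sum gs v.
Proof.
elim: gs v => [|g gs IH] v vP /=; first by apply/rowP => j; rewrite mxE; exact: vP.
have /choice[u uP] j := vP j; have /choice[w wP] j := uP j.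
exists (\row_j (u j : R)), (\row_j (w j : R)); split.
  by apply: IH => j; rewrite mxE; case: (wP j).
by apply/rowP => j; rewrite !mxE; case: (wP j).
Qed.

Variable gs : seq R.
Hypothesis gs_normal : forall g, g \in gs -> normal_elt g.
Local Notation J := (@scaled_sum R^o gs).

Lemma scaled_sum_mul c e : J e -> J (c * e).
Proof.
have [J0 Jlin] := scaled_sum_submodule R^o gs_normal.
by move=> Je; rewrite -[c * e]addr0; apply: (Jlin c e 0).
Qed.

Lemma scaled_sum_add e e' : J e -> J e' -> J (e + e').
Proof.
have [J0 Jlin] := scaled_sum_submodule R^o gs_normal.
by move=> Je Je'; rewrite -[e]mul1r; apply: (Jlin 1 e e').
Qed.

Lemma scaled_sum_gen g : g \in gs -> J g.
Proof. by move=> gG; rewrite -[g]mulr1; exact: (scaled_sum_mem (1 : R^o) gG). Qed.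

(** As [1 < n], each monomial of the norm has positive degree [n.-1], so it ends in [u] (for
    [i = 0]) or in [v]. *)
Lemma scaled_sum_trunc_norm (u v : R) n : (1 < n)%N ->
  J u -> J v -> J (trunc_norm u v n).
Proof.
move=> n_gt1 Ju Jv; have [J0 _] := scaled_sum_submodule R^o gs_normal.
rewrite /trunc_norm; elim/big_rec: _ => // i e _ Je; apply: scaled_sum_add Je.
case: i => [[|i] /= _]; last by rewrite exprSr mulrA; apply: scaled_sum_mul.
by rewrite mulr1 subn0 -(subnK n_gt1) addn2 /= exprSr; apply: scaled_sum_mul.
Qed.

Lemma scaled_sum_xper Q xl xr n i s : xl \in gs -> xr \in gs -> (1 < n)%N ->
  J (xper Q xl xr n i s).
Proof.
move=> /scaled_sum_gen Jl /scaled_sum_gen Jr n_gt1; rewrite /xper.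
case: (odd i); last by apply: scaled_sum_trunc_norm => //; apply: scaled_sum_mul.
by apply: scaled_sum_add; [|rewrite -mulN1r]; apply: scaled_sum_mul.
Qed.

Lemma scaled_sum_yper Q yl yr n i s : yl \in gs -> yr \in gs -> (1 < n)%N ->
  J (yper Q yl yr n i s).
Proof.
move=> /scaled_sum_gen Jl /scaled_sum_gen Jr n_gt1; rewrite /yper.
case: (odd i); last by apply: scaled_sum_trunc_norm => //; apply: scaled_sum_mul.
by apply: scaled_sum_add => //; rewrite -mulNr; apply: scaled_sum_mul.
Qed.

Lemma scaled_sum_tot_d V H n (u : 'rV[R]_n.+2) :
  (forall i m, J (V i m)) -> (forall i m, J (H i m)) -> scaled_sum gs (tot_d V H u).
Proof.
move=> JV JH; apply: scaled_sum_row => j; rewrite mxE.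
by apply: scaled_sum_add; apply: scaled_sum_mul.
Qed.

End FreeModules.

(** * The monomial basis *)

(** Here [true] is the letter [Y] and [false] is [X]; the pairs counted are those in which a [Y]
    precedes an [X]. *)
Fixpoint inversions (s : seq bool) : nat :=
  if s is c :: s' then (inversions s' + if c then count negb s' else 0)%N else 0%N.

Lemma inversions_cat s t :
  inversions (s ++ t) = (inversions s + inversions t + count id s * count negb t)%N.
Proof.
elim: s => [|c s IH] /=; first by rewrite addn0.
by rewrite IH; case: c; rewrite /= ?add0n ?addn0 // add1n mulSn count_cat; lia.
Qed.

Section Words.
Variable k : fieldType.

Definition word (s : seq bool) : free_alg k bool := << FMonom s >>.

Lemma free_alg_ind (P : free_alg k bool -> Prop) :
  P 0 -> (forall c s g, P g -> P (c *: word s + g)) -> forall g, P g.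
Proof.
move=> P0 PD g; have := monalgE (g : {malg k[{fmonom bool}]}) => ->.
elim: (enum_fset _) => [|[s] r IH]; first by rewrite big_nil.
rewrite big_cons; suff -> : << g@_(FMonom s) *g FMonom s >> =
  g@_(FMonom s) *: word s :> free_alg k bool by apply: PD.
by apply/malgP => w; rewrite mcoeffZ !mcoeffU; case: eqP; rewrite ?mulr1 ?mulr0.
Qed.

Lemma wordM s t : word s * word t = word (s ++ t).
Proof.
rewrite /word [LHS](malgM_def (<< FMonom s >> : {malg k[{fmonom bool}]})) fgmulUU mulr1.
by congr (<< _ *g _ >>); exact: fmmulE.
Qed.

Lemma word_nil : word [::] = 1.
Proof. by rewrite /word -fmoneE. Qed.

Lemma wordX n c : word [:: c] ^+ n = word (nseq n c).
Proof. by elim: n => [|n IH]; rewrite ?word_nil // exprS IH wordM. Qed.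

Lemma free_XE : free_X k = word [:: false].
Proof. by rewrite /free_X /free_var fmuE. Qed.

Lemma free_YE : free_Y k = word [:: true].
Proof. by rewrite /free_Y /free_var fmuE. Qed.

End Words.

(** * Coefficient functionals and the monomial basis of [A] *)

Section QciBasis.
Variables (k : fieldType) (q : k) (a b : nat).
Hypotheses (q_neq0 : q != 0) (a_ge2 : (1 < a)%N) (b_ge2 : (1 < b)%N).
Local Notation A := (qci q a_ge2 b_ge2).
Local Notation x := (qci_x q a_ge2 b_ge2).
Local Notation y := (qci_y q a_ge2 b_ge2).
Local Notation pi := (alg_pi (@qci_proper k q a b a_ge2 b_ge2)).

(* In [A] the word [s] equals [q^-(inversions s) x^i y^j], where [i] and [j]
   count its letters. *)
Definition word_coef (i j : nat) (s : seq bool) : k :=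
  if (count negb s == i) && (count id s == j) then q^-1 ^+ inversions s else 0.

Definition free_coef (i j : nat) (g : free_alg k bool) : k :=
  mmap idfun (fun m : {fmonom bool} => word_coef i j m) g.

Lemma free_coef_lin i j c g h :
  free_coef i j (c *: g + h) = c * free_coef i j g + free_coef i j h.
Proof.
rewrite /free_coef [LHS]mmapD; congr (_ + _).
rewrite [LHS](mmapEw (msuppZ_le _ _)) mmapE big_distrr /=.
by apply: eq_bigr => w _; rewrite mcoeffZ mulrA.
Qed.

Lemma free_coef0 i j : free_coef i j 0 = 0.
Proof. exact: mmap0. Qed.

Lemma free_coef_word i j s : free_coef i j (word k s) = word_coef i j s.
Proof. by rewrite /free_coef /word [LHS]mmapU mul1r. Qed.

(** A factor [X ^+ a] or [Y ^+ b] pushes a letter count out of range. Turning [XY] into [YX] adds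
    one inversion, whose [q^-1] cancels the coefficient [q]. *)
Lemma free_coef_relation i j s : (i < a)%N -> (j < b)%N -> qci_relation q a b s ->
  forall l r, free_coef i j (word k l * s * word k r) = 0.
Proof.
move=> ia jb; case=> [||] l r.
- rewrite free_XE wordX !wordM free_coef_word /word_coef !count_cat.
  by rewrite !count_nseq /= mul1n; case: eqP => //=; lia.
- rewrite free_XE free_YE mulrBr mulrBl -scalerAr -scalerAl !wordM.
  rewrite addrC -scaleNr free_coef_lin !free_coef_word /word_coef.
  rewrite !count_cat /= [(0 + 1)%N]addnC; case: ifP => _; last by rewrite mulr0 addr0.
  rewrite !inversions_cat !count_cat /= !(addn0, add0n, muln1, addn1).
  by rewrite !addSn exprS mulNr mulrA divff // mul1r addNr.
- rewrite free_YE wordX !wordM free_coef_word /word_coef !count_cat.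
  by rewrite !count_nseq /= mul1n andbC; case: eqP => //=; lia.
Qed.

Lemma free_coef_ideal i j g : (i < a)%N -> (j < b)%N ->
  ideal_gen (qci_relation q a b) g -> free_coef i j g = 0.
Proof.
move=> ia jb; elim=> [|l s r u Ss _ IH]; first exact: free_coef0.
rewrite -[l * s * r]scale1r free_coef_lin IH addr0 mul1r.
elim/free_alg_ind: l => [|c l g' IHl]; first by rewrite !mul0r free_coef0.
rewrite !mulrDl -(scalerAl c (word k l) s) -(scalerAl c (word k l * s) r).
rewrite free_coef_lin [X in _ + X]IHl addr0.
suff -> : free_coef i j (word k l * s * r) = 0 by rewrite mulr0.
elim/free_alg_ind: r {IHl} => [|c' r g'' IHr]; first by rewrite !mulr0 free_coef0.
rewrite mulrDr -(scalerAr c' (word k l * s) (word k r)) free_coef_lin [X in _ + X]IHr addr0.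
by rewrite free_coef_relation ?mulr0.
Qed.

(** For [i < a] and [j < b] the choice of representative is immaterial, since [free_coef] vanishes
    on the ideal. *)
Definition qci_coef (i j : nat) (z : A) : k := free_coef i j (repr z).

Lemma qci_coef_pi i j g : (i < a)%N -> (j < b)%N ->
  qci_coef i j (pi g) = free_coef i j g.
Proof.
move=> ia jb; apply: subr0_eq.
have := free_coef_ideal ia jb (alg_repr_pi (@qci_proper k q a b a_ge2 b_ge2) g).
by rewrite addrC -scaleN1r free_coef_lin mulN1r addrC.
Qed.

Lemma qci_coef_lin i j c z z' : (i < a)%N -> (j < b)%N ->
  qci_coef i j (c *: z + z') = c * qci_coef i j z + qci_coef i j z'.
Proof.
move=> ia jb; rewrite -[z]alg_reprK -[z']alg_reprK -alg_piZ -alg_piD.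
by rewrite !qci_coef_pi // free_coef_lin.
Qed.

Lemma qci_xE : x = pi (word k [:: false]).
Proof. by rewrite qci_x_unlock free_XE. Qed.

Lemma qci_yE : y = pi (word k [:: true]).
Proof. by rewrite qci_y_unlock free_YE. Qed.

Lemma alg_pi_exp g n : pi (g ^+ n) = pi g ^+ n.
Proof. by elim: n => [|n IH]; rewrite ?alg_pi1 // !exprS alg_piM IH. Qed.

Lemma pi_relation s : qci_relation q a b s -> pi s = 0.
Proof.
move=> Ss; have <- : pi 0 = 0 by rewrite -[LHS](addrK (pi 0)) -alg_piD addr0 subrr.
by apply/alg_piP; rewrite subr0; apply: ideal_gen_mem.
Qed.

Lemma qci_x_nilp : x ^+ a = 0.
Proof. by rewrite qci_x_unlock -alg_pi_exp pi_relation //; constructor. Qed.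

Lemma qci_y_nilp : y ^+ b = 0.
Proof. by rewrite qci_y_unlock -alg_pi_exp pi_relation //; constructor. Qed.

Lemma qci_xy : x * y = q *: (y * x).
Proof.
rewrite qci_x_unlock qci_y_unlock -!alg_piM -alg_piZ.
by apply/alg_piP/ideal_gen_mem; constructor.
Qed.

Lemma qci_yx n : y * x ^+ n = q^-1 ^+ n *: (x ^+ n * y).
Proof.
elim: n => [|n IH]; first by rewrite mul1r mulr1 scale1r.
have yx : y * x = q^-1 *: (x * y) by rewrite qci_xy scalerA mulVf // scale1r.
by rewrite exprSr mulrA IH -scalerAl -!mulrA yx -scalerAr scalerA -exprSr mulrA.
Qed.

Lemma pi_word s :
  pi (word k s) = q^-1 ^+ inversions s *: (x ^+ count negb s * y ^+ count id s).
Proof.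
elim: s => [|c s IH]; first by rewrite word_nil alg_pi1 scale1r mul1r.
rewrite -[c :: s]cat1s -wordM alg_piM IH; case: c => /=.
  rewrite -qci_yE -scalerAr mulrA qci_yx -scalerAl scalerA -exprD.
  by rewrite -mulrA -exprS add1n.
by rewrite -qci_xE addn0 add0n add1n -scalerAr mulrA -exprS.
Qed.

Lemma qci_coefE i j i' j' : (i < a)%N -> (j < b)%N ->
  qci_coef i j (x ^+ i' * y ^+ j') = ((i' == i) && (j' == j))%:R.
Proof.
move=> ia jb; rewrite qci_xE qci_yE -!alg_pi_exp !wordX -alg_piM wordM.
rewrite qci_coef_pi // free_coef_word /word_coef !count_cat !count_nseq /=.
rewrite !(mul1n, mul0n, addn0, add0n) inversions_cat !count_nseq /=.
case: andP => //= _; have inv_nseq n c : inversions (nseq n c) = 0%N.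
  by elim: n => //= n ->; case: c; rewrite // count_nseq.
by rewrite !inv_nseq.
Qed.

Lemma qci_coef0 i j : (i < a)%N -> (j < b)%N -> qci_coef i j 0 = 0.
Proof.
move=> ia jb; have := qci_coef_lin (-1) 0 0 ia jb.
by rewrite scaler0 addr0 mulN1r addNr.
Qed.

(** The exponents are unbounded so that the sorted form of any word is covered: out of range both
    sides are zero. *)
Lemma qci_monomial_span m n : x ^+ m * y ^+ n =
  \sum_(i < a) \sum_(j < b) ((m == i) && (n == j))%:R *: (x ^+ i * y ^+ j).
Proof.
have [ma|am] := ltnP m a; last first.
  have -> : x ^+ m = 0 by rewrite -(subnK am) exprD qci_x_nilp mulr0.
  rewrite mul0r big1 // => i _; rewrite big1 // => j _.
  by rewrite gtn_eqF ?scale0r // (leq_trans (ltn_ord i)).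
have [nb|bn] := ltnP n b; last first.
  have -> : y ^+ n = 0 by rewrite -(subnK bn) exprD qci_y_nilp mulr0.
  rewrite mulr0 big1 // => i _; rewrite big1 // => j _.
  by rewrite [n == j]gtn_eqF ?andbF ?scale0r // (leq_trans (ltn_ord j)).
rewrite (bigD1 (Ordinal ma)) // (bigD1 (Ordinal nb)) //= !eqxx scale1r.
rewrite !big1 ?addr0 // => [i im|j jn].
  by rewrite big1 // => j _; rewrite eq_sym (negbTE (im : i != m :> nat)) scale0r.
by rewrite [n == _]eq_sym (negbTE (jn : j != n :> nat)) scale0r.
Qed.

Lemma qci_span z :
  z = \sum_(i < a) \sum_(j < b) qci_coef i j z *: (x ^+ i * y ^+ j).
Proof.
rewrite -[z]alg_reprK; elim/free_alg_ind: (repr z) => [|c s g IH].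
  have -> : pi 0 = 0 by rewrite -[LHS](addrK (pi 0)) -alg_piD addr0 subrr.
  rewrite big1 // => i _; rewrite big1 // => j _.
  by rewrite qci_coef0 // scale0r.
rewrite alg_piD alg_piZ {1}IH pi_word scalerA {1}qci_monomial_span.
rewrite scaler_sumr -big_split; apply: eq_bigr => i _ /=.
rewrite scaler_sumr -big_split; apply: eq_bigr => j _ /=.
by rewrite scalerA -scalerDl qci_coef_lin // qci_coefE.
Qed.

End QciBasis.

(** * Scalars and pure tensors in the enveloping algebra *)

Section EnvelopeScalars.
Variables (k : comNzRingType) (A : algType k).
Implicit Types (w z : A) (e : envelope A).

Lemma escaleAl c e e' : escale c (e * e') = escale c e * e'.
Proof. by rewrite !escale_unlock; exact: tensor_scalerAl. Qed.

Lemma escaleAr c e e' : escale c (e * e') = e * escale c e'.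
Proof. by rewrite !escale_unlock; exact: tensor_scalerAr. Qed.

Lemma escaleA c c' e : escale c (escale c' e) = escale (c * c') e.
Proof. by rewrite !escale_unlock scalerA. Qed.

Lemma escale_mul1 c e : escale c e = escale c 1 * e.
Proof. by rewrite -escaleAl mul1r. Qed.

Lemma escale_etensr c w z : escale c (etens w z) = etens w (c *: z).
Proof. by rewrite escale_unlock !etens_unlock; exact/esym/(@tensZr k A A^c). Qed.

Lemma escale1_comm c e : GRing.comm (escale c 1) e.
Proof. by rewrite /GRing.comm -escale_mul1 -escaleAr mulr1. Qed.

Lemma escale1X c n : escale c 1 ^+ n = escale (c ^+ n) (1 : envelope A).
Proof. by elim: n => [|n IH]; rewrite ?escale1 // !exprS IH -escale_mul1 escaleA. Qed.

Lemma etensDl w w' z : etens (w + w') z = etens w z + etens w' z.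
Proof. by rewrite !etens_unlock tensDl. Qed.

Lemma etensDr w z z' : etens w (z + z') = etens w z + etens w z'.
Proof. by rewrite !etens_unlock; exact: (@tensDr k A A^c). Qed.

Lemma etensBl w w' z : etens (w - w') z = etens w z - etens w' z.
Proof. by rewrite !etens_unlock tensDl tensNl. Qed.

Lemma etensXl w n : etens w 1 ^+ n = etens (w ^+ n) 1.
Proof. by elim: n => [|n IH]; rewrite ?etens11 // !exprS IH etensM mulr1. Qed.

Lemma etensXr z n : etens 1 z ^+ n = etens 1 (z ^+ n).
Proof. by elim: n => [|n IH]; rewrite ?etens11 // exprSr IH etensM mulr1 exprS. Qed.

Lemma etens0l z : etens 0 z = 0.
Proof. by rewrite etens_unlock tens0l. Qed.

Lemma etens0r w : etens w 0 = 0.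
Proof. by rewrite etens_unlock; exact: (@tens0r k A A^c). Qed.

Lemma etens_sumr (I : Type) (r : seq I) (P : pred I) (F : I -> A) w :
  etens w (\sum_(i <- r | P i) F i) = \sum_(i <- r | P i) etens w (F i).
Proof. exact: (big_morph (etens w) (etensDr w) (etens0r w)). Qed.

End EnvelopeScalars.

(** * The enveloping algebra as a free module over its left factor *)

Section EnvelopeBasis.
Variables (k : fieldType) (q : k) (a b : nat).
Hypotheses (q_neq0 : q != 0) (a_ge2 : (1 < a)%N) (b_ge2 : (1 < b)%N).
Local Notation A := (qci q a_ge2 b_ge2).
Local Notation x := (qci_x q a_ge2 b_ge2).
Local Notation y := (qci_y q a_ge2 b_ge2).
Local Notation R := (envelope A).
Local Notation Q := (escale q (1 : R)).
Local Notation Q' := (escale q^-1 (1 : R)).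
Local Notation xl := (etens x 1 : R).
Local Notation xr := (etens (1 : A) x : R).
Local Notation yl := (etens y 1 : R).
Local Notation yr := (etens (1 : A) y : R).

Definition left_elt (e : R) : Prop := exists w, e = etens w 1.

Lemma left_elt_mul w e : left_elt e -> left_elt (e * etens w 1).
Proof. by move=> [w' ->]; exists (w' * w); rewrite etensM mulr1. Qed.

Lemma left_elt_scale c e : left_elt e -> left_elt (e * escale c 1).
Proof.
move=> [w ->]; exists (c *: w); rewrite -escale_etens [RHS]escale_mul1.
exact/commr_sym/escale1_comm.
Qed.

Lemma left_eltB e e' : left_elt e -> left_elt e' -> left_elt (e - e').
Proof. by move=> [w ->] [w' ->]; exists (w - w'); rewrite etensBl. Qed.

(** Right factors multiply in the opposite order, so [yr] must precede [xr] to give the basis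
    monomials of [qci_span]. *)
Lemma etens_monomial w i j : etens w 1 * yr ^+ j * xr ^+ i = etens w (x ^+ i * y ^+ j).
Proof. by rewrite !etensXr !etensM !mulr1. Qed.

Lemma envelope_span (e : R) : exists2 c : nat -> nat -> R, forall i j, left_elt (c i j) &
  e = \sum_(i < a) (\sum_(j < b) c i j * yr ^+ j) * xr ^+ i.
Proof.
elim/envelope_ind: e => [|w z e [c Cc eE]].
  exists (fun _ _ => 0) => [i j|]; first by exists 0; rewrite etens0l.
  by rewrite big1 // => i _; rewrite big1 ?mul0r // => j _; rewrite mul0r.
exists (fun i j => etens (qci_coef i j z *: w) 1 + c i j) => [i j|].
  have [w' ->] := Cc i j; exists (qci_coef i j z *: w + w').
  by rewrite etensDl.
rewrite eE {1}(qci_span q_neq0 z) etens_sumr -big_split; apply: eq_bigr => i _ /=.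
rewrite etens_sumr !mulr_suml -big_split; apply: eq_bigr => j _ /=.
by rewrite !mulrDl etens_monomial -escale_etens escale_etensr.
Qed.

(** The map [id ⊗ qci_coef i j], which isolates the left factor of one basis monomial. *)
Definition env_coef (i j : nat) : R -> A :=
  tensor_lift (fun (w : A) (z : A^c) => qci_coef i j (z : A) *: w).

Lemma env_coef_bilin i j : (i < a)%N -> (j < b)%N ->
  tensor_bilinear (fun (w : A) (z : A^c) => qci_coef i j (z : A) *: w).
Proof.
move=> ia jb; split=> [u u' v|u v v'|c u v|c u v].
- exact: scalerDr.
- by rewrite -scalerDl -[v in LHS]scale1r qci_coef_lin // mul1r.
- by rewrite !scalerA mulrC.
- by rewrite scalerA -[c *: v]addr0 qci_coef_lin // qci_coef0 // addr0.
Qed.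

Lemma envelope_free (c : nat -> nat -> R) : (forall i j, left_elt (c i j)) ->
  \sum_(i < a) (\sum_(j < b) c i j * yr ^+ j) * xr ^+ i = 0 ->
  forall i j, (i < a)%N -> (j < b)%N -> c i j = 0.
Proof.
move=> Cc c0 i j ia jb; pose f := env_coef i j.
have f_bilin := env_coef_bilin ia jb.
have f0 : f 0 = 0 := tensor_lift0 f_bilin.
have fD : {morph f : e e' / e + e'} := tensor_liftD f_bilin.
have fE w z : f (etens w z) = qci_coef i j z *: w.
  by rewrite /f /env_coef etens_unlock (tensor_liftE f_bilin).
have [w cE] := Cc i j; suff w0 : w = 0 by rewrite cE w0 etens0l.
have := congr1 f c0; rewrite f0 (big_morph f fD f0) => <-.
have term i' j' w' : f (etens w' 1 * yr ^+ j' * xr ^+ i') =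
    ((i' == i) && (j' == j))%:R *: w'.
  by rewrite etens_monomial fE qci_coefE.
rewrite (bigD1 (Ordinal ia)) //= mulr_suml (big_morph f fD f0).
rewrite (bigD1 (Ordinal jb)) //= cE term !eqxx scale1r.
rewrite !big1 ?addr0 // => [i' i'i|j' j'j].
  rewrite mulr_suml (big_morph f fD f0) big1 // => j' _.
  by have [w' ->] := Cc i' j'; rewrite term (negbTE (i'i : i' != i :> nat)) scale0r.
have [w' ->] := Cc i j'; rewrite term (negbTE (j'j : j' != j :> nat)) andbF.
by rewrite scale0r.
Qed.

End EnvelopeBasis.

(** * Exactness and minimality *)

Section Resolution.
Variables (k : fieldType) (q : k) (a b : nat).
Hypotheses (q_neq0 : q != 0) (a_ge2 : (1 < a)%N) (b_ge2 : (1 < b)%N).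
Local Notation A := (qci q a_ge2 b_ge2).
Local Notation x := (qci_x q a_ge2 b_ge2).
Local Notation y := (qci_y q a_ge2 b_ge2).
Local Notation R := (envelope A).
Local Notation Q := (escale q (1 : R)).
Local Notation Q' := (escale q^-1 (1 : R)).
Local Notation xl := (etens x 1 : R).
Local Notation xr := (etens (1 : A) x : R).
Local Notation yl := (etens y 1 : R).
Local Notation yr := (etens (1 : A) y : R).

Let a_gt0 : (0 < a)%N := ltnW a_ge2.
Let b_gt0 : (0 < b)%N := ltnW b_ge2.

Let Q_comm w : GRing.comm Q w. Proof. exact: escale1_comm. Qed.

Let xl_yl : xl * yl = Q * (yl * xl).
Proof. by rewrite -escale_mul1 !etensM mulr1 escale_etens -qci_xy. Qed.

Let yr_xr : yr * xr = Q * (xr * yr).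
Proof. by rewrite -escale_mul1 !etensM mulr1 escale_etensr -qci_xy. Qed.

Lemma etens_comm (w z : A) : GRing.comm (etens w 1 : R) (etens 1 z).
Proof. by rewrite /GRing.comm !etensM !mulr1 !mul1r. Qed.

Let xl_yr : GRing.comm xl yr. Proof. exact: etens_comm. Qed.
Let xl_xr : GRing.comm xl xr. Proof. exact: etens_comm. Qed.
Let yl_yr : GRing.comm yl yr. Proof. exact: etens_comm. Qed.
Let xr_yl : GRing.comm xr yl. Proof. exact/commr_sym/etens_comm. Qed.

Let xla : xl ^+ a = 0. Proof. by rewrite etensXl qci_x_nilp etens0l. Qed.
Let xra : xr ^+ a = 0. Proof. by rewrite etensXr qci_x_nilp etens0r. Qed.
Let ylb : yl ^+ b = 0. Proof. by rewrite etensXl qci_y_nilp etens0l. Qed.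
Let yrb : yr ^+ b = 0. Proof. by rewrite etensXr qci_y_nilp etens0r. Qed.

Let QQ' : Q * Q' = 1.
Proof. by rewrite -escale_mul1 escaleA divff // escale1. Qed.

Let C_B (e e' : R) : left_elt e -> left_elt e' -> left_elt (e - e').
Proof. exact: left_eltB. Qed.
Let C_mul w (e : R) : left_elt e -> left_elt (e * etens w 1).
Proof. exact: left_elt_mul. Qed.
Let C_scale c (e : R) : left_elt e -> left_elt (e * escale c 1).
Proof. exact: left_elt_scale. Qed.
Let C_span := @envelope_span k q a b q_neq0 a_ge2 b_ge2.
Let C_free := @envelope_free k q a b q_neq0 a_ge2 b_ge2.

Local Notation xp := (xper Q xl xr a).
Local Notation yp := (yper Q yl yr b).

(** The twist is the degree of the generator in the other variable, whose increments are those
    required by [xper_yper]; the sign makes the squares anticommute. *)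
Definition res_V (i m : nat) : R := (-1) ^+ i * yp m (per_deg a i).
Definition res_H (i m : nat) : R := xp i (per_deg b m).

Lemma res_VV i m : res_V i m.+1 * res_V i m = 0.
Proof.
rewrite /res_V -mulrA (mulrA (yp _ _)) (commr_sign (yp m.+1 _) i) -mulrA.
by rewrite (yper_yper Q_comm yl_yr ylb yrb) !mulr0.
Qed.

Lemma res_HH i m : res_H i.+1 m * res_H i m = 0.
Proof. exact: (xper_xper Q_comm xl_xr xla xra). Qed.

Lemma res_VH i m :
  res_V i.+1 m.+1 * res_H i.+1 m + res_H i.+1 m.+1 * res_V i m.+1 = 0.
Proof.
rewrite /res_V /res_H !per_degS // (mulrA (xp _ _)) (commr_sign (xp _ _) i).
rewrite -!mulrA (xper_yper Q_comm xl_yl yr_xr xl_yr xr_yl a_gt0 b_gt0).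
by rewrite exprS mulN1r mulNr addNr.
Qed.

Lemma res_H_exact i m w : w * res_H i.+1 m = 0 ->
  exists w', w = w' * res_H i.+2 m.
Proof.
exact: (xper_exact Q_comm xl_yr xl_xr a_gt0 xla xra QQ' (escale1_comm _)
  C_B (@C_mul x) (@C_scale q) (@C_scale q^-1) C_span C_free).
Qed.

Lemma res_V_coker_exact m w w' : w * res_V 0 m.+1 = w' * res_H 1 m ->
  exists w0 w1, w = w0 * res_V 0 m.+2 + w1 * res_H 1 m.+1.
Proof.
rewrite /res_V /res_H !mul1r (per_degS m b_gt0) /per_deg muln0.
exact: (yper_coker_exact Q_comm xl_yl yr_xr xl_yr xr_yl xl_xr yl_yr a_gt0 b_gt0
  xla xra ylb yrb QQ' (escale1_comm _) C_B (@C_mul x) (@C_mul y)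
  (@C_scale q) (@C_scale q^-1) C_span C_free).
Qed.

Lemma modulo_res_d0 w : exists w0 w1 z,
  w = w0 * res_V 0 1 + w1 * res_H 1 0 + etens z 1.
Proof.
have [w0 [w1 [_ [[z ->] wE]]]] :=
  modulo_diffs Q_comm xl_yr xl_xr yl_yr QQ' (escale1_comm _)
  C_B (@C_mul x) (@C_mul y) (@C_scale q^-1) C_span w.
by exists w0, w1, z; rewrite /res_V /res_H mul1r /per_deg !muln0.
Qed.

End Resolution.

Lemma sum_mul_delta (R : pzRingType) n (f : 'I_n.+1 -> R) l : (l < n.+1)%N ->
  \sum_(i < n.+1) f i * (i == l :> nat)%:R = f (inord l).
Proof.
move=> ln; rewrite (bigD1 (inord l)) //= inordK // eqxx mulr1 big1 ?addr0 // => i.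
by rewrite -val_eqE /= inordK // => /negbTE ->; rewrite mulr0.
Qed.

(** * The explicit differentials as those of the total complex *)

Section Differentials.
Variables (k : fieldType) (q : k) (a b : nat).
Hypotheses (a_ge2 : (1 < a)%N) (b_ge2 : (1 < b)%N).
Local Notation A := (qci q a_ge2 b_ge2).
Local Notation x := (qci_x q a_ge2 b_ge2).
Local Notation y := (qci_y q a_ge2 b_ge2).
Local Notation R := (envelope A).
Local Notation Q := (escale q (1 : R)).
Local Notation xl := (etens x 1 : R).
Local Notation xr := (etens (1 : A) x : R).
Local Notation yl := (etens y 1 : R).
Local Notation yr := (etens (1 : A) y : R).

Lemma tau1E s : tau1 q a_ge2 b_ge2 s = xdiff Q xl xr s.
Proof. by rewrite /tau1 escale_mul1 -escale1X. Qed.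

Lemma tau2E s : tau2 q a_ge2 b_ge2 s = ydiff Q yl yr s.
Proof. by rewrite /tau2 escale_mul1 -escale1X. Qed.

Lemma scaled_expr (w : R) s n :
  (Q ^+ s * w) ^+ n = escale (q ^+ (n * s)) (w ^+ n).
Proof.
rewrite [RHS]escale_mul1 exprMn_comm; last by rewrite escale1X; apply: escale1_comm.
by rewrite -exprM escale1X mulnC.
Qed.

Lemma gamma1E s : gamma1 q a_ge2 b_ge2 s = xnorm Q xl xr a s.
Proof.
rewrite /gamma1 /xnorm /trunc_norm big_mkord; apply: eq_bigr => i _.
by rewrite scaled_expr -escaleAr etensXl etensXr etensM !mulr1 subn1.
Qed.

Lemma gamma2E s : gamma2 q a_ge2 b_ge2 s = ynorm Q yl yr b s.
Proof.
(* [gamma2] is indexed by the power of [yl], the norm by that of [yr]. *)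
rewrite /gamma2 /ynorm /trunc_norm big_mkord (reindex_inj rev_ord_inj).
apply: eq_bigr => i _ /=.
rewrite scaled_expr -escaleAl etensXl etensXr etensM !mulr1.
have ib := ltn_ord i; have -> : (b - i.+1 = b.-1 - i)%N by lia.
by have -> : (b - 1 - (b.-1 - i) = i)%N by lia.
Qed.

Lemma half_eq m n : m = n.*2 -> m./2 = n.
Proof. by move=> ->; rewrite doubleK. Qed.

(** The generator [i] of degree [n.+1] sits at [(i, m)] with [m = n.+1 - i]. The four formulas
    correspond to the parities of [m] and [i], and the halved twists are [per_deg a i] and
    [per_deg b m]. *)
Lemma res_d_basisE n i : (i <= n.+1)%N ->
  res_d_basis q a_ge2 b_ge2 n i =
    res_V q a_ge2 b_ge2 i (n.+1 - i) *: res_f q a_ge2 b_ge2 n i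
      + res_H q a_ge2 b_ge2 i (n.+1 - i) *: res_f q a_ge2 b_ge2 n (i%:Z - 1).
Proof.
move=> i_le; set m := (n.+1 - i)%N; have nE : n.+1 = (m + i)%N by rewrite subnK.
rewrite /res_d_basis nE oddD /res_V /res_H -(signr_odd _ i) /xper /yper /per_deg.
rewrite !(tau1E, tau2E, gamma1E, gamma2E).
have := odd_double_half i; have := odd_double_half m.
move: (m./2) (i./2) => m' i'.
case: (odd m); case: (odd i) => /= <- <-; rewrite ?expr0 ?expr1 ?mul1r ?mulN1r.
- rewrite (@half_eq _ (a * i' + 1)); last by nia.
  rewrite (@half_eq (_ - b + 2)%N (b * m' + 1)); last by nia.
  by [].
- rewrite (@half_eq (a * _) (a * i' + 0)); last by nia.
  rewrite (@half_eq (_ + 2)%N (b * m' + 1)); last by nia.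
  by [].
- rewrite (@half_eq (_ + 2)%N (a * i' + 1)); last by nia.
  rewrite (@half_eq (_ + b - _)%N (b * m' + 0)); last by nia.
  by [].
rewrite (@half_eq (a * _)%N (a * i' + 0)); last by nia.
rewrite (@half_eq (_ - _)%N (b * m' + 0)); last by nia.
by [].
Qed.

Lemma res_dE_tot n (v : res_P q a_ge2 b_ge2 n.+1) :
  res_d q a_ge2 b_ge2 n v =
    tot_d (res_V q a_ge2 b_ge2) (res_H q a_ge2 b_ge2) (v : 'rV[R]_n.+2).
Proof.
change (res_d_fun v = tot_d (res_V q a_ge2 b_ge2) (res_H q a_ge2 b_ge2) (v : 'rV[R]_n.+2)).
apply: row_inordP => j jn; rewrite tot_dE // /res_d_fun summxE.
pose w : 'rV[R]_n.+2 := v.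
(* Entry [j] receives the vertical term of [i = j] and the horizontal term of [i = j.+1]. *)
transitivity (\sum_(i < n.+2)
    (w 0 i * res_V q a_ge2 b_ge2 i (n.+1 - i) * (i == j :> nat)%:R
      + w 0 i * res_H q a_ge2 b_ge2 i (n.+1 - i) * (i == j.+1 :> nat)%:R)).
  apply: eq_bigr => i _; rewrite mxE res_d_basisE -1?ltnS // !mxE inordK //.
  rewrite mulrDr !mulrA; congr (_ * _%:R + _ * _%:R).
    by rewrite eq_sym.
  by lia.
by rewrite big_split /= !sum_mul_delta ?ltnS // ?leqW // !inordK ?ltnS ?leqW //.
Qed.

End Differentials.

Lemma mem_seq4 (T : eqType) (s t u v : T) (l := [:: s; t; u; v]) :
  [/\ s \in l, t \in l, u \in l & v \in l].
Proof. by rewrite !inE !eqxx !orbT. Qed.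

(** * Normal nilpotent generators, and exactness of the augmented complex *)

Section Minimality.
Variables (k : fieldType) (q : k) (a b : nat).
Hypotheses (q_neq0 : q != 0) (a_ge2 : (1 < a)%N) (b_ge2 : (1 < b)%N).
Local Notation A := (qci q a_ge2 b_ge2).
Local Notation x := (qci_x q a_ge2 b_ge2).
Local Notation y := (qci_y q a_ge2 b_ge2).
Local Notation R := (envelope A).
Local Notation Q := (escale q (1 : R)).
Local Notation xl := (etens x 1 : R).
Local Notation xr := (etens (1 : A) x : R).
Local Notation yl := (etens y 1 : R).
Local Notation yr := (etens (1 : A) y : R).
Local Notation V := (res_V q a_ge2 b_ge2).
Local Notation H := (res_H q a_ge2 b_ge2).
Local Notation d := (res_d q a_ge2 b_ge2).
Local Notation mu := (res_mu q a_ge2 b_ge2).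

(** The scalars and the four letters generate [R] as a ring, so normality of an element need only be
    tested against the letters. *)
Lemma envelope_gen_ind (P : R -> Prop) :
  (forall e e', P e -> P e' -> P (e + e')) ->
  (forall e e', P e -> P e' -> P (e * e')) ->
  (forall c, P (escale c 1)) -> P xl -> P xr -> P yl -> P yr ->
  forall e, P e.
Proof.
move=> PD PM PZ Pxl Pxr Pyl Pyr.
have P0 : P 0 by have := PZ 0; rewrite escale_unlock scale0r.
have P1 : P 1 by rewrite -(escale1 (1 : R)).
have PX e n : P e -> P (e ^+ n).
  by move=> Pe; elim: n => // n IH; rewrite exprS; apply: PM.
have Psum n (f : 'I_n -> R) : (forall i, P (f i)) -> P (\sum_i f i).
  by move=> Pf; elim/big_rec: _ => // i e _ Pe; apply: PD.
have Pl w : P (etens w 1).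
  have -> : etens w 1 = \sum_(i < a) \sum_(j < b)
      escale (qci_coef i j w) 1 * (xl ^+ i * yl ^+ j) :> R.
    rewrite {1}(qci_span q_neq0 w) (big_morph (fun z => etens z 1 : R)
      (fun z z' => etensDl z z' 1) (etens0l 1)); apply: eq_bigr => i _.
    rewrite (big_morph (fun z => etens z 1 : R)
      (fun z z' => etensDl z z' 1) (etens0l 1)); apply: eq_bigr => j _.
    by rewrite !etensXl etensM mulr1 -escale_mul1 escale_etens.
  by apply: (Psum) => i; apply: (Psum) => j; apply/PM/(PM)/(PX) => //; apply: (PX).
apply: envelope_ind => // w z e Pe; apply: PD => //.
rewrite (qci_span q_neq0 z) etens_sumr; apply: (Psum) => i.
rewrite etens_sumr; apply: (Psum) => j; rewrite -escale_etensr -etens_monomial.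
by rewrite escale_mul1; apply/PM/PM/PX => //; apply/PM/PX.
Qed.

Lemma normal_gen (g : R) :
  (exists e, xl * g = g * e) -> (exists e, xr * g = g * e) ->
  (exists e, yl * g = g * e) -> (exists e, yr * g = g * e) -> normal_elt g.
Proof.
move=> nxl nxr nyl nyr; apply: envelope_gen_ind => //.
- by move=> e e' [f fE] [f' fE']; exists (f + f'); rewrite mulrDl mulrDr fE fE'.
- move=> e e' [f fE] [f' fE']; exists (f * f').
  by rewrite -mulrA fE' mulrA fE mulrA.
- by move=> c; exists (escale c 1); apply: escale1_comm.
Qed.

Definition env_gens : seq R := [:: xl; xr; yl; yr].

Lemma qci_yx1 : y * x = q^-1 *: (x * y).
Proof. by rewrite qci_xy scalerA mulVf // scale1r. Qed.

(** Letters on opposite sides commute, and those on the same side commute up to a power of [q]. *)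
Lemma env_gens_normal (g : R) : g \in env_gens -> normal_elt g.
Proof.
have swap w z : etens w 1 * etens 1 z = etens 1 z * etens w 1 :> R by apply: etens_comm.
rewrite !inE => /or4P[] /eqP->; apply: normal_gen.
- by exists xl.
- by exists xr; rewrite swap.
- by exists (escale q^-1 yl); rewrite -escaleAr !etensM mulr1 escale_etens qci_yx1.
- by exists yr; rewrite swap.
- by exists xl; rewrite swap.
- by exists xr.
- by exists yl; rewrite swap.
- by exists (escale q yr); rewrite -escaleAr !etensM mulr1 escale_etensr qci_xy.
- by exists (escale q xl); rewrite -escaleAr !etensM mulr1 escale_etens qci_xy.
- by exists xr; rewrite swap.
- by exists yl.
- by exists yr; rewrite swap.
- by exists xl; rewrite swap.
- by exists (escale q^-1 xr); rewrite -escaleAr !etensM mulr1 escale_etensr qci_yx1.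
- by exists yl; rewrite swap.
- by exists yr.
Qed.

Lemma env_gens_nilp (g : R) : g \in env_gens -> exists n, g ^+ n = 0.
Proof.
rewrite !inE => /or4P[] /eqP->; [exists a|exists a|exists b|exists b];
  by rewrite ?etensXl ?etensXr ?qci_x_nilp ?qci_y_nilp ?etens0l ?etens0r.
Qed.

Lemma image_in_radical n (u : 'rV[R]_n.+2) : scaled_sum env_gens (tot_d V H u).
Proof.
have [xl_in xr_in yl_in yr_in] := mem_seq4 xl xr yl yr.
apply: (scaled_sum_tot_d env_gens_normal) => i m.
  rewrite /res_V; apply: (scaled_sum_mul env_gens_normal).
  exact: (scaled_sum_yper env_gens_normal Q m (per_deg a i) yl_in yr_in b_ge2).
rewrite /res_H.
exact: (scaled_sum_xper env_gens_normal Q i (per_deg b m) xl_in xr_in a_ge2).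
Qed.

Lemma superfluous_image n (K : 'rV[R]_n.+1 -> Prop) :
  (forall v, K v -> exists u, tot_d V H u = v) ->
  superfluous (K : ('rV[R]_n.+1 : lmodType R) -> Prop).
Proof.
move=> Kd; apply: (@superfluous_sub _ _ _ (@scaled_sum R ('rV[R]_n.+1 : lmodType R) env_gens)).
  by move=> v /Kd[u <-]; apply: image_in_radical.
apply: superfluous_scaled_sum => g gG; split; first exact: env_gens_normal.
exact: env_gens_nilp.
Qed.

Lemma envelope_mul_opp (e : R) : envelope_mul (- e) = - envelope_mul e.
Proof. by rewrite -mulN1r envelope_mulM scaleN1r. Qed.

Lemma envelope_mul_V : envelope_mul (V 0 1) = 0.
Proof.
rewrite /res_V /yper /ydiff /per_deg muln0 !mul1r envelope_mulD envelope_mul_opp.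
by rewrite !envelope_mul_tens mul1r mulr1 subrr.
Qed.

Lemma envelope_mul_H : envelope_mul (H 1 0) = 0.
Proof.
rewrite /res_H /xper /xdiff /per_deg muln0 mul1r envelope_mulD envelope_mul_opp.
by rewrite !envelope_mul_tens mul1r mulr1 subrr.
Qed.

Lemma res_d_exact n : exact_at (d n.+1) (d n).
Proof.
move=> v; rewrite res_dE_tot.
have [to_im of_im] := tot_exact (@res_VV k q a b a_ge2 b_ge2)
  (@res_HH k q a b a_ge2 b_ge2) (@res_VH k q a b a_ge2 b_ge2)
  (@res_H_exact k q a b q_neq0 a_ge2 b_ge2)
  (@res_V_coker_exact k q a b q_neq0 a_ge2 b_ge2) v.
split=> [/to_im[u uE]|[u uE]]; first by exists u; rewrite res_dE_tot.
by apply: of_im; exists u; rewrite -res_dE_tot.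
Qed.

Lemma res_mu_exact : exact_at (d 0) mu.
Proof.
move=> v; split=> [|[u <-]]; last first.
  rewrite res_dE_tot; change (envelope_mul (tot_d V H u 0 0) = 0).
  rewrite mxE !subn0 envelope_mulD (envelope_mulM _ (V 0 1)) (envelope_mulM _ (H 1 0)).
  by rewrite envelope_mul_V envelope_mul_H !scaler0 addr0.
change (envelope_mul ((v : 'rV[R]_1) 0 0) = 0 -> exists u, d 0 u = v).
(* Modulo the image of [d 0] the element is [z ⊗ 1], which [mu] sends to [z]; so [z = 0], and [w0],
   [w1] form a preimage. *)
have [w0 [w1 [z vE]]] := modulo_res_d0 q_neq0 ((v : 'rV[R]_1) 0 0).
rewrite vE !envelope_mulD (envelope_mulM _ (V 0 1)) (envelope_mulM _ (H 1 0)).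
rewrite envelope_mul_V envelope_mul_H.
rewrite !scaler0 !add0r envelope_mul_tens mulr1 => z0.
pose u : 'rV[R]_2 := \row_j (if j == 0 :> nat then w0 else w1).
exists u; rewrite res_dE_tot; apply: row_inordP => j; rewrite leqn0 => /eqP->.
rewrite tot_dE // ![u _ _]mxE !inordK //= !subn0.
have -> : inord 0 = 0 :> 'I_1 by apply: ord1.
by rewrite vE z0 etens0l addr0.
Qed.

Lemma res_mu_surj m : exists p, mu p = m.
Proof.
exists (const_mx (etens (m : A) 1)).
change (envelope_mul ((const_mx (etens (m : A) 1) : 'rV[R]_1) 0 0) = m).
by rewrite mxE envelope_mul_tens mulr1.
Qed.

End Minimality.

Theorem proposition2p1 (k : fieldType) (q : k) (a b : nat) (q_neq0 : q != 0)
    (a_ge2 : (2 <= a)%N) (b_ge2 : (2 <= b)%N) :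
  let d := res_d q a_ge2 b_ge2 in
  let mu := res_mu q a_ge2 b_ge2 in
  exact_augmented d mu /\ minimal_projective_resolution d mu.
Proof.
have exact_d := @res_d_exact k q a b q_neq0 a_ge2 b_ge2.
have exact_mu := @res_mu_exact k q a b q_neq0 a_ge2 b_ge2.
have surj_mu := @res_mu_surj k q a b a_ge2 b_ge2.
have sup n := @superfluous_image k q a b q_neq0 a_ge2 b_ge2 n.
split=> //; split.
- by split=> // n; apply: projective_rV.
- by apply: (sup 0) => v /(exact_mu v)[u <-]; exists u; rewrite res_dE_tot.
by move=> n; apply: (sup n.+1) => v /(exact_d n v)[u <-]; exists u; rewrite res_dE_tot.
Qed.
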